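(* Let $f$ satisfy the hypotheses (f1), (f2) described in the context, let $B\in[1,\infty)$ be the associated exponent, let $g,v,\tilde u,R_1,R_2$ be as defined in the context, and assume that $$\lim_{x\to 0}(-\log|x|)^{1/2}\,[R_1(x)+R_2(x)]=0 .$$ Then there exists a singular solution $u$ of $-\Delta u=f(u)$ (locally around the origin of $\mathbb{R}^2$) satisfying $$u(x)=\tilde u(x)+O\Big(f(\tilde u(x))\,F(\tilde u(x))\,\sup_{|y|\le|x|}\big(R_1(y)+R_2(y)\big)\Big)\qquad\text{as } |x|\to 0 .$$
   Context: The space dimension is $N=2$. Write $B_R=\{x\in\mathbb{R}^2:|x|<R\}$. A function $u\ge 0$ is a singular solution of $-\Delta u=f(u)$ (around the origin) if there is $r_0>0$ such that $u\in C^2(B_{r_0}\setminus\{0\})$, $-\Delta u=f(u)$ in $B_{r_0}\setminus\{0\}$ in the classical sense, and $u(x)\to\infty$ as $|x|\to0$. (f1): $f\in C^2((s_0,\infty))$ for some $s_0>0$, and for all $s>s_0$: $f(s)>0$, $f'(s)>0$ and $F(s):=\int_s^\infty \frac{d\tau}{f(\tau)}<\infty$. For large $s$ define $B_1[f](s)$ and $B_2[f](s)$ through their reciprocals: $$\frac1{B_1[f](s)}:=(-\log F(s))\,[1-f'(s)F(s)],\qquad \frac1{B_2[f](s)}:=f'(s)F(s)\,(-\log F(s))^2\Big[\frac{f(s)f''(s)F(s)}{f'(s)}-1\Big].$$ $B_1[g],B_2[g]$ are defined in the same way with $f,F$ replaced by $g,G$. (f2): the limits $\lim_{s\to\infty}f'(s)F(s)$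 and $\lim_{s\to\infty}B_2[f](s)$ exist, $\lim_{s\to\infty}f'(s)F(s)=1$, and $B:=\lim_{s\to\infty}B_2[f](s)\in[1,\infty)$. Model nonlinearity and model solution: if $B>1$, let $B'$ be the Hölder conjugate ($1/B+1/B'=1$) and $$v(x)=\Big(\log\frac1{|x|^2}\Big)^{1/B'},\quad g(s)=\frac{4}{BB'}s^{1-2B'}e^{s^{B'}},\quad G(s)=\int_s^\infty\frac{d\tau}{g(\tau)}=\frac B4\,\frac{s^{B'}+1}{e^{s^{B'}}};$$ if $B=1$, $$v(x)=\log\log\frac1{|x|^2},\quad g(s)=4\frac{e^{e^s}}{e^{2s}},\quad G(s)=\int_s^\infty\frac{d\tau}{g(\tau)}=\frac14\,\frac{e^s+1}{e^{e^s}}.$$ For $x\ne0$ close to $0$, $\tilde u(x):=F^{-1}[G(v(x))]$, and $$R_i(x):=\Big|\frac1{B_i[f](\tilde u(x))}-\frac1{B_i[g](v(x))}\Big|,\qquad i=1,2.$$ *)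

(* Defs.v *)
From Stdlib Require Import Reals.
From Coquelicot Require Import Coquelicot.
Open Scope R_scope.

Definition origin : R * R := (0, 0).

(* Coquelicot's norm on a product is the Euclidean one,
   sqrt (norm (fst x) ^ 2 + norm (snd x) ^ 2). *)
Definition enorm (x : R * R) : R := norm x.

Definition laplacian (u : R * R -> R) (x : R * R) : R :=
  let w := fun a b => u (a, b) in
  partial_derive 2 0 w (fst x) (snd x) + partial_derive 0 2 w (fst x) (snd x).

(* [ex_diff_n w 2] at every point of an open set is the class C^2 there.
   Since f is only given on (s0, +oo), the equation is required to make
   sense, whence the clause [s0 < u x]. *)
Definition singular_solution (s0 : R) (f : R -> R) (u : R * R -> R) : Prop :=
  exists r0 : R, 0 < r0 /\
    (forall x : R * R, 0 < enorm x < r0 ->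
       0 <= u x /\ s0 < u x /\
       ex_diff_n (fun a b => u (a, b)) 2 (fst x) (snd x) /\
       - laplacian u x = f (u x)) /\
    filterlim u (locally' origin) (Rbar_locally p_infty).

(* F(s), the integral of 1/f over (s, +oo). *)
Definition tail (f : R -> R) (s : R) : R :=
  RInt_gen (fun t => / f t) (at_point s) (Rbar_locally p_infty).

(* The inverse of F : (s0, +oo) -> R; unspecified outside the range of F. *)
Definition tail_inv (s0 : R) (f : R -> R) (y : R) : R :=
  iota (fun s : R => s0 < s /\ tail f s = y).

(* 1/B_1[f] and 1/B_2[f]. *)
Definition recip_B1 (f : R -> R) (s : R) : R :=
  - ln (tail f s) * (1 - Derive f s * tail f s).

Definition recip_B2 (f : R -> R) (s : R) : R :=
  Derive f s * tail f s * (- ln (tail f s)) ^ 2 *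
  (f s * Derive_n f 2 s * tail f s / Derive f s - 1).

Definition B2 (f : R -> R) (s : R) : R := / recip_B2 f s.

(* Lower-order derivatives are required to exist explicitly, because
   [Derive_n] is a total function. *)
Definition cond_f1 (s0 : R) (f : R -> R) : Prop :=
  0 < s0 /\
  forall s : R, s0 < s ->
    (forall k : nat, (k <= 2)%nat ->
       ex_derive_n f k s /\ continuous (Derive_n f k) s) /\
    0 < f s /\ 0 < Derive f s /\
    ex_RInt_gen (fun t => / f t) (at_point s) (Rbar_locally p_infty).

Definition cond_f2 (f : R -> R) (B : R) : Prop :=
  is_lim (fun s => Derive f s * tail f s) p_infty 1 /\
  is_lim (B2 f) p_infty B /\
  1 <= B.

(* The Hölder conjugate of B > 1. *)
Definition conj_exp (B : R) : R := B / (B - 1).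

Definition model_g (B s : R) : R :=
  if Req_EM_T B 1 then 4 * (exp (exp s) / exp (2 * s))
  else 4 / (B * conj_exp B) * Rpower s (1 - 2 * conj_exp B)
       * exp (Rpower s (conj_exp B)).

Definition model_v (B : R) (x : R * R) : R :=
  if Req_EM_T B 1 then ln (ln (1 / enorm x ^ 2))
  else Rpower (ln (1 / enorm x ^ 2)) (1 / conj_exp B).

Definition u_tilde (s0 : R) (f : R -> R) (B : R) (x : R * R) : R :=
  tail_inv s0 f (tail (model_g B) (model_v B x)).

Definition rem1 (s0 : R) (f : R -> R) (B : R) (x : R * R) : R :=
  Rabs (recip_B1 f (u_tilde s0 f B x) - recip_B1 (model_g B) (model_v B x)).

Definition rem2 (s0 : R) (f : R -> R) (B : R) (x : R * R) : R :=
  Rabs (recip_B2 f (u_tilde s0 f B x) - recip_B2 (model_g B) (model_v B x)).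

(* sup of h over 0 < |y| <= |x|, to be used only where it is finite:
   [real] sends an infinite supremum to 0. *)
Definition ball_sup (h : R * R -> R) (x : R * R) : R :=
  real (Lub_Rbar (fun r => exists y : R * R, 0 < enorm y <= enorm x /\ r = h y)).

Definition big_O (L : (R * R -> Prop) -> Prop) (h w : R * R -> R) : Prop :=
  exists C : R, L (fun x => Rabs (h x) <= C * Rabs (w x)).

(* Main.v *)
Require Import Defs.
From Stdlib Require Import Reals Lra Lia.
From Coquelicot Require Import Coquelicot.
Open Scope R_scope.

(** In the variable t = log(1/|x|^2) the radial equation reads
    u'' = - e^(-t) f(u) / 4, and G(v) = (B/4) (t + 1) e^(-t) for every B >= 1.
    With m = f(u~) F(u~), the function u~ = F^(-1)(G(v)) solves the equation up to
    the error - m (t/(t+1))^2 d, where d = O(R_1/t) and d' = O((R_1 + R_2)/t^2).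
    Writing u = u~ + w and w = sqrt(sigma) q with t = (B/4) sigma^2 (Liouville's
    substitution) turns the linearised equation into q'' + q = h + N(sigma, q),
    solved from infinity by Duhamel's formula.  Since h is slowly varying, one
    integration by parts gives q = O(h) without the loss of t^(1/2) of a crude
    estimate; the nonlinear part N is contracting exactly because
    t^(1/2) (R_1 + R_2) tends to 0.  All bounds are pointwise multiples of
    m(t) sup_{s >= t} (R_1 + R_2), so the fixed point inherits the claimed error. *)

(** * Integrals over half-lines *)

(** The defect d compares 1 - f'F along u~ with the same quantity for the model g: for f = g it
    vanishes and u~ is an exact solution. R_1 controls d. R_2 is needed because integrating by parts
    differentiates the forcing, and the derivative of 1 - f'F along u~ is -t/(t+1) times f'F times
    the bracket in 1/B_2. Put M = m sup (R_1 + R_2). In the variable sigma, h has size M /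
    sqrt(sigma), too large to integrate absolutely, while h' has size M / sigma^(3/2), whose tail
    integral is again of size M / sqrt(sigma). The nonlinear term must reach the same class. As m is
    the natural length scale of f at u~, a perturbation w = O(k m) gives a relative linearisation
    error O(k), with k a multiple of the supremum; this has to be small against 1/sigma, that is
    against t^(-1/2). M may vanish and, containing a supremum, need not be continuous. Hence no
    weighted norm is used: only the monotonicity of M enters, and the Picard iterates converge
    pointwise. The constant 410 B is 10 times 41 B, where 41 B bounds h and h' and 10 = 5 (1 + 1/2 +
    1/4 + ...) comes from the Picard series. *)

Lemma locally_gt (a x : R) : a < x -> locally x (fun y => a < y).
Proof.
  intros H; exact (open_gt a x H).
Qed.

Lemma ex_RInt_continuous_gt (f : R -> R) (a x y : R) :
  (forall t, a < t -> continuous f t) -> a < x -> a < y -> ex_RInt f x y.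
Proof.
  intros Hf Hx Hy; apply (ex_RInt_continuous (V := R_CompleteNormedModule)).
  intros z Hz; apply Hf.
  apply Rlt_le_trans with (2 := proj1 Hz); apply Rmin_glb_lt; assumption.
Qed.

Lemma is_RInt_gen_p_infty (f : R -> R) (a l : R) :
  (forall b, a <= b -> ex_RInt f a b) ->
  filterlim (fun b => RInt f a b) (Rbar_locally p_infty) (locally l) ->
  is_RInt_gen f (at_point a) (Rbar_locally p_infty) l.
Proof.
  intros He Hl P HP.
  apply (Filter_prod _ _ _ (fun x => x = a) (fun b => a <= b /\ P (RInt f a b))).
  - reflexivity.
  - apply filter_and; [|exact (Hl P HP)].
    exists a; intros x Hx; apply Rlt_le, Hx.
  - intros x b -> [Hb HPb]; exists (RInt f a b); split; [|exact HPb].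
    apply (RInt_correct (V := R_CompleteNormedModule)), He, Hb.
Qed.

Lemma RInt_gen_minus_RInt (f : R -> R) (a x y : R) :
  (forall t, a < t -> continuous f t) -> a < x -> a < y ->
  ex_RInt_gen f (at_point x) (Rbar_locally p_infty) ->
  ex_RInt_gen f (at_point y) (Rbar_locally p_infty) /\
  RInt_gen f (at_point y) (Rbar_locally p_infty) =
    RInt_gen f (at_point x) (Rbar_locally p_infty) - RInt f x y.
Proof.
  intros Hc Hx Hy [l Hl].
  assert (Hxy := ex_RInt_continuous_gt f a x y Hc Hx Hy).
  assert (Hyx := ex_RInt_continuous_gt f a y x Hc Hy Hx).
  assert (H : is_RInt_gen f (at_point y) (Rbar_locally p_infty) (l - RInt f x y)).
  { replace (l - RInt f x y) with (@plus R_NormedModule (RInt f y x) l).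
    - apply (is_RInt_gen_Chasles (V := R_NormedModule) f x (RInt f y x) l); [|exact Hl].
      apply is_RInt_gen_at_point, (RInt_correct (V := R_CompleteNormedModule)), Hyx.
    - rewrite <- (opp_RInt_swap f x y Hxy).
      unfold plus, opp; simpl; ring. }
  split; [exists (l - RInt f x y); exact H|].
  rewrite (is_RInt_gen_unique f _ H), (is_RInt_gen_unique f _ Hl); reflexivity.
Qed.

(** The margin [a < x] makes the integrand continuous on both sides of [x], so that the derivative
    is two-sided. *)
Lemma is_derive_RInt_gen (f : R -> R) (a x : R) :
  (forall t, a < t -> continuous f t) -> a < x ->
  ex_RInt_gen f (at_point x) (Rbar_locally p_infty) ->
  is_derive (fun s => RInt_gen f (at_point s) (Rbar_locally p_infty)) x (- f x).
Proof.
  intros Hc Hx He.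
  apply is_derive_ext_loc with
    (fun y => RInt_gen f (at_point x) (Rbar_locally p_infty) - RInt f x y).
  { generalize (locally_gt a x Hx); apply filter_imp; intros y Hy.
    symmetry; apply (RInt_gen_minus_RInt f a x y Hc Hx Hy He). }
  evar_last.
  - apply (is_derive_minus (K := R_AbsRing) (V := R_NormedModule)).
    + apply (is_derive_const (K := R_AbsRing) (V := R_NormedModule)).
    + apply is_derive_RInt with x; [|apply Hc, Hx].
      generalize (locally_gt a x Hx); apply filter_imp; intros y Hy.
      apply (RInt_correct (V := R_CompleteNormedModule)).
      apply (ex_RInt_continuous_gt f a x y Hc Hx Hy).
  - unfold minus, plus, opp, zero; simpl; ring.
Qed.

Lemma filterlim_RInt_p_infty (f : R -> R) (x l : R) :
  is_RInt_gen f (at_point x) (Rbar_locally p_infty) l ->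
  filterlim (fun b => RInt f x b) (Rbar_locally p_infty) (locally l).
Proof.
  intros H P HP; destruct (H P HP) as [Q1 Q2 H1 H2 H3].
  unfold filtermap; generalize H2; apply filter_imp; intros b Hb.
  destruct (H3 x b H1 Hb) as [y [Hy HPy]].
  simpl in Hy; rewrite (is_RInt_unique _ _ _ _ Hy); exact HPy.
Qed.

Lemma filterlim_RInt_gen_0 (f : R -> R) (a x : R) :
  (forall t, a < t -> continuous f t) -> a < x ->
  ex_RInt_gen f (at_point x) (Rbar_locally p_infty) ->
  filterlim (fun s => RInt_gen f (at_point s) (Rbar_locally p_infty))
    (Rbar_locally p_infty) (locally 0).
Proof.
  intros Hc Hx He; assert (He' := He); destruct He' as [l Hl].
  assert (H := filterlim_RInt_p_infty f x l Hl).
  apply (filterlim_ext_loc (fun y => l - RInt f x y)).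
  { exists a; intros y Hy.
    rewrite (proj2 (RInt_gen_minus_RInt f a x y Hc Hx Hy He)).
    rewrite (is_RInt_gen_unique f _ Hl); reflexivity. }
  replace 0 with (l - l) by ring.
  apply (is_lim_minus' (fun _ => l) (fun y => RInt f x y) p_infty l l).
  - apply is_lim_const.
  - exact H.
Qed.

(** Cauchy's criterion: between two points the partial integral of [f] moves no more than that of
    [g], whose partial integrals converge. *)
Lemma ex_RInt_gen_dominated (f g : R -> R) (a x : R) :
  (forall t, a < t -> continuous f t) -> a < x ->
  (forall t, x <= t -> Rabs (f t) <= g t) ->
  ex_RInt_gen g (at_point x) (Rbar_locally p_infty) ->
  (forall t, a < t -> continuous g t) ->
  ex_RInt_gen f (at_point x) (Rbar_locally p_infty) /\
  Rabs (RInt_gen f (at_point x) (Rbar_locally p_infty)) <=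
    RInt_gen g (at_point x) (Rbar_locally p_infty).
Proof.
  intros Hf Hx Hfg [l Hl] Hg.
  assert (Hlim := filterlim_RInt_p_infty g x l Hl).
  assert (He : ex_RInt_gen f (at_point x) (Rbar_locally p_infty)).
  { destruct (proj1 (filterlim_locally_cauchy (U := R_CompleteSpace)
      (F := Rbar_locally p_infty) (fun b => RInt f x b))) as [y Hy].
    - intros eps.
      destruct (proj2 (filterlim_locally_cauchy (U := R_CompleteSpace)
        (F := Rbar_locally p_infty) (fun b => RInt g x b)) (ex_intro _ l Hlim) eps)
        as [P [HP HPe]].
      exists (fun b => P b /\ x < b); split.
      { apply filter_and; [exact HP|]. exists x; intros; assumption. }
      assert (Hkey : forall u v, P u -> P v -> x < u -> u <= v ->
        Rabs (RInt f x v - RInt f x u) < eps).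
      { intros u v Pu Pv Hu Huv.
        assert (B := HPe u v Pu Pv).
        unfold ball in B; simpl in B; unfold AbsRing_ball, abs, minus, plus, opp in B;
          simpl in B.
        assert (Ef : RInt f x v - RInt f x u = RInt f u v).
        { rewrite <- (RInt_Chasles f x u v).
          - unfold plus; simpl; ring.
          - apply (ex_RInt_continuous_gt f a); auto; lra.
          - apply (ex_RInt_continuous_gt f a); auto; lra. }
        assert (Eg : RInt g x v + - RInt g x u = RInt g u v).
        { rewrite <- (RInt_Chasles g x u v).
          - unfold plus; simpl; ring.
          - apply (ex_RInt_continuous_gt g a); auto; lra.
          - apply (ex_RInt_continuous_gt g a); auto; lra. }
        rewrite Ef; rewrite Eg in B.
        apply Rle_lt_trans with (2 := B).
        apply Rle_trans with (2 := Rle_abs _).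
        apply Rle_trans with (RInt (fun t => Rabs (f t)) u v).
        { apply abs_RInt_le; [exact Huv|].
          apply (ex_RInt_continuous_gt f a); auto; lra. }
        apply RInt_le; [exact Huv| | |].
        - apply (ex_RInt_continuous_gt (fun t => Rabs (f t)) a); try lra.
          intros t Ht; apply (continuous_comp f Rabs); [apply Hf, Ht|].
          apply continuous_Rabs.
        - apply (ex_RInt_continuous_gt g a); auto; lra.
        - intros t Ht; apply Hfg; lra. }
      intros u v [Pu Hu] [Pv Hv].
      change (Rabs (RInt f x v - RInt f x u) < eps).
      destruct (Rle_dec u v) as [H|H].
      + apply Hkey; assumption.
      + rewrite Rabs_minus_sym; apply (Hkey v u); auto; lra.
    - exists y; apply is_RInt_gen_p_infty; [|exact Hy].
      intros b Hb; apply (ex_RInt_continuous_gt f a); auto; lra. }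
  split; [exact He|].
  assert (Hfl := RInt_gen_correct _ He).
  apply (RInt_gen_norm (V := R_CompleteNormedModule) (Fa := at_point x)
    (Fb := Rbar_locally p_infty) f g).
  - apply (Filter_prod _ _ _ (fun y => y = x) (fun b => x < b)).
    + reflexivity.
    + exists x; intros; assumption.
    + simpl; intros y b -> Hb; lra.
  - apply (Filter_prod _ _ _ (fun y => y = x) (fun b => x < b)).
    + reflexivity.
    + exists x; intros; assumption.
    + simpl; intros y b -> Hb t Ht; apply Hfg; lra.
  - exact Hfl.
  - apply (RInt_gen_correct (V := R_CompleteNormedModule)); exists l; exact Hl.
Qed.

Lemma is_RInt_gen_antiderivative (F f : R -> R) (a x : R) :
  (forall t, a < t -> is_derive F t (f t)) ->
  (forall t, a < t -> continuous f t) -> a < x ->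
  filterlim F (Rbar_locally p_infty) (locally 0) ->
  is_RInt_gen f (at_point x) (Rbar_locally p_infty) (- F x).
Proof.
  intros HF Hf Hx Hl.
  apply is_RInt_gen_p_infty.
  { intros b Hb; apply (ex_RInt_continuous_gt f a); auto; lra. }
  apply (filterlim_ext_loc (fun b => F b - F x)).
  { exists x; intros b Hb; symmetry.
    apply is_RInt_unique, (is_RInt_derive F f).
    - intros t Ht; rewrite Rmin_left in Ht by lra; apply HF; lra.
    - intros t Ht; rewrite Rmin_left in Ht by lra; apply Hf; lra. }
  replace (- F x) with (0 - F x) by ring.
  apply (is_lim_minus' F (fun _ => F x) p_infty 0 (F x)).
  - exact Hl.
  - apply is_lim_const.
Qed.

Lemma filterlim_const_div_sqrt (D : R) :
  filterlim (fun t => D / sqrt t) (Rbar_locally p_infty) (locally 0).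
Proof.
  replace 0 with (D * 0) by ring.
  apply (is_lim_scal_l (fun t => / sqrt t) D p_infty 0).
  apply (is_lim_inv sqrt p_infty p_infty); [|discriminate].
  apply filterlim_sqrt_p.
Qed.

Lemma is_RInt_gen_pow_three_halves (D x : R) : 0 < x ->
  is_RInt_gen (fun t => D / (t * sqrt t)) (at_point x) (Rbar_locally p_infty)
    (2 * D / sqrt x).
Proof.
  intros Hx.
  replace (2 * D / sqrt x) with (- (- (2 * D) / sqrt x))
    by (field; apply Rgt_not_eq, sqrt_lt_R0, Hx).
  apply (is_RInt_gen_antiderivative (fun t => - (2 * D) / sqrt t) _ 0);
    [| |exact Hx|apply filterlim_const_div_sqrt].
  - intros t Ht; assert (Hs := sqrt_lt_R0 t Ht).
    auto_derive.
    + split; [exact Ht|]; split; [lra|exact I].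
    + rewrite <- (sqrt_sqrt t) at 4 by lra. field. lra.
  - intros t Ht; assert (Hs := sqrt_lt_R0 t Ht).
    apply (ex_derive_continuous (K := R_AbsRing) (V := R_NormedModule)).
    auto_derive; split; [exact Ht|]. split; [|exact I].
    apply Rgt_not_eq, Rmult_lt_0_compat; assumption.
Qed.

(** The exponent 3/2 is the decay of both h' and the nonlinear term in the phase variable;
    integrating it returns the rate 1 / sqrt x of h. *)
Lemma RInt_gen_three_halves_bound (g : R -> R) (D a x : R) :
  0 <= a < x -> (forall t, a < t -> continuous g t) ->
  (forall t, x <= t -> Rabs (g t) <= D / (t * sqrt t)) ->
  ex_RInt_gen g (at_point x) (Rbar_locally p_infty) /\
  Rabs (RInt_gen g (at_point x) (Rbar_locally p_infty)) <= 2 * D / sqrt x.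
Proof.
  intros Ha Hg Hb.
  assert (H := is_RInt_gen_pow_three_halves D x ltac:(lra)).
  rewrite <- (is_RInt_gen_unique _ _ H).
  apply ex_RInt_gen_dominated with a; auto; [lra| |].
  - eexists; exact H.
  - intros t Ht; assert (Hs := sqrt_lt_R0 t ltac:(lra)).
    apply (ex_derive_continuous (K := R_AbsRing) (V := R_NormedModule)).
    auto_derive; split; [lra|]. split; [|exact I].
    apply Rgt_not_eq, Rmult_lt_0_compat; lra.
Qed.

(** * Forced oscillator *)

Definition tail_integral (g : R -> R) (x : R) : R :=
  RInt_gen g (at_point x) (Rbar_locally p_infty).

Definition ex_tail_integral (g : R -> R) (x : R) : Prop :=
  ex_RInt_gen g (at_point x) (Rbar_locally p_infty).

(* The solution h + int_x^oo (cos (t - x) h' t + sin (t - x) n t) dt of q'' + q = h + n: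
   the contribution of h is integrated by parts, since h itself is not integrable. *)
Definition duhamel (h h' n : R -> R) (x : R) : R :=
  h x + cos x * tail_integral (fun t => cos t * h' t + sin t * n t) x
      + sin x * tail_integral (fun t => sin t * h' t - cos t * n t) x.

(** The derivative of [duhamel]. No term in [h'] stands outside the integrals: the derivative of [h]
    is cancelled by the endpoint terms, since sin^2 + cos^2 = 1. *)
Definition duhamel' (h' n : R -> R) (x : R) : R :=
  - sin x * tail_integral (fun t => cos t * h' t + sin t * n t) x
  + cos x * tail_integral (fun t => sin t * h' t - cos t * n t) x.

(** Continuity and strict positivity are left out on purpose: the weight used later contains a
    supremum of remainders, which may jump or vanish. *)
Definition weight (S : R) (M : R -> R) : Prop :=
  0 <= S /\ (forall x, S < x -> 0 <= M x) /\
  (forall x y, S < x -> x <= y -> M y <= M x).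

(** Beyond [x] the weight is at most [M x], which therefore comes out of the integral. *)
Lemma tail_integral_weight (S D : R) (M g : R -> R) (x : R) :
  weight S M -> 0 <= D -> S < x ->
  (forall t, S < t -> continuous g t) ->
  (forall t, S < t -> Rabs (g t) <= D * M t / (t * sqrt t)) ->
  ex_tail_integral g x /\ Rabs (tail_integral g x) <= 2 * D * M x / sqrt x.
Proof.
  intros (HS & HM & Hmon) HD Hx Hg Hb.
  replace (2 * D * M x / sqrt x) with (2 * (D * M x) / sqrt x)
    by (unfold Rdiv; ring).
  apply (RInt_gen_three_halves_bound g (D * M x) S); auto.
  intros t Ht; apply Rle_trans with (1 := Hb t ltac:(lra)).
  assert (Hs := sqrt_lt_R0 t ltac:(lra)).
  apply Rmult_le_compat_r.
  - apply Rlt_le, Rinv_0_lt_compat, Rmult_lt_0_compat; lra.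
  - apply Rmult_le_compat_l; [exact HD|]. apply Hmon; lra.
Qed.

Lemma continuous_sin_cos_comb (S : R) (u v : R -> R) :
  (forall t, S < t -> continuous u t) -> (forall t, S < t -> continuous v t) ->
  (forall t, S < t -> continuous (fun t => cos t * u t + sin t * v t) t) /\
  (forall t, S < t -> continuous (fun t => sin t * u t - cos t * v t) t).
Proof.
  intros Hu Hv.
  assert (Hc : forall t, continuous cos t)
    by (intros; apply (ex_derive_continuous (V := R_NormedModule)); auto_derive; auto).
  assert (Hs : forall t, continuous sin t)
    by (intros; apply (ex_derive_continuous (V := R_NormedModule)); auto_derive; auto).
  split; intros t Ht.
  - apply (continuous_plus (V := R_NormedModule));
      apply (continuous_mult (K := R_AbsRing)); auto.
  - apply (continuous_minus (V := R_NormedModule));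
      apply (continuous_mult (K := R_AbsRing)); auto.
Qed.

Lemma Rabs_sin_cos_comb (t a b : R) :
  Rabs (cos t * a + sin t * b) <= Rabs a + Rabs b /\
  Rabs (sin t * a - cos t * b) <= Rabs a + Rabs b.
Proof.
  assert (Hc : Rabs (cos t) <= 1) by (apply Rabs_le; apply COS_bound).
  assert (Hs : Rabs (sin t) <= 1) by (apply Rabs_le; apply SIN_bound).
  assert (Ha := Rabs_pos a). assert (Hb := Rabs_pos b).
  split.
  - apply Rle_trans with (1 := Rabs_triang _ _); rewrite !Rabs_mult; nra.
  - unfold Rminus; apply Rle_trans with (1 := Rabs_triang _ _).
    rewrite Rabs_Ropp, !Rabs_mult; nra.
Qed.

Lemma tail_integral_comb (S D : R) (M u v : R -> R) (x : R) :
  weight S M -> 0 <= D -> S < x ->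
  (forall t, S < t -> continuous u t) -> (forall t, S < t -> continuous v t) ->
  (forall t, S < t -> Rabs (u t) + Rabs (v t) <= D * M t / (t * sqrt t)) ->
  (ex_tail_integral (fun t => cos t * u t + sin t * v t) x /\
   Rabs (tail_integral (fun t => cos t * u t + sin t * v t) x) <= 2 * D * M x / sqrt x) /\
  (ex_tail_integral (fun t => sin t * u t - cos t * v t) x /\
   Rabs (tail_integral (fun t => sin t * u t - cos t * v t) x) <= 2 * D * M x / sqrt x).
Proof.
  intros HM HD Hx Hu Hv Hb.
  destruct (continuous_sin_cos_comb S u v Hu Hv) as [H1 H2].
  split; apply (tail_integral_weight S); auto; intros t Ht;
    apply Rle_trans with (2 := Hb t Ht); apply Rabs_sin_cos_comb.
Qed.

Lemma Rdiv_weight_pos (S D : R) (M : R -> R) (x : R) :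
  weight S M -> 0 <= D -> S < x ->
  0 <= D * M x / sqrt x /\ 0 <= D * M x / (x * sqrt x).
Proof.
  intros (HS & HM & _) HD Hx.
  assert (Hs := sqrt_lt_R0 x ltac:(lra)).
  assert (H := HM x Hx).
  split; apply Rmult_le_pos; try (apply Rmult_le_pos; assumption);
    apply Rlt_le, Rinv_0_lt_compat; [exact Hs|].
  apply Rmult_lt_0_compat; lra.
Qed.

Lemma is_derive_duhamel (S C D : R) (M h h' n : R -> R) :
  weight S M -> 0 <= C -> 0 <= D ->
  (forall x, S < x -> is_derive h x (h' x)) ->
  (forall x, S < x -> continuous h' x) -> (forall x, S < x -> continuous n x) ->
  (forall x, S < x -> Rabs (h' x) <= C * M x / (x * sqrt x)) ->
  (forall x, S < x -> Rabs (n x) <= D * M x / (x * sqrt x)) ->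
  forall x, S < x ->
    is_derive (duhamel h h' n) x (duhamel' h' n x) /\
    is_derive (duhamel' h' n) x (h x + n x - duhamel h h' n x).
Proof.
  intros HM HC HD Hh Hh' Hn Bh' Bn x Hx.
  destruct (continuous_sin_cos_comb S h' n Hh' Hn) as [C1 C2].
  destruct (tail_integral_comb S (C + D) M h' n x HM ltac:(lra) Hx Hh' Hn)
    as [[E1 _] [E2 _]].
  { intros t Ht; replace ((C + D) * M t / (t * sqrt t))
      with (C * M t / (t * sqrt t) + D * M t / (t * sqrt t)) by (unfold Rdiv; ring).
    apply Rplus_le_compat; auto. }
  assert (D1 := is_derive_RInt_gen _ S x C1 Hx E1).
  assert (D2 := is_derive_RInt_gen _ S x C2 Hx E2).
  fold (tail_integral (fun t => cos t * h' t + sin t * n t)) in D1.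
  change (is_derive (tail_integral (fun t => cos t * h' t + sin t * n t)) x
    (- (cos x * h' x + sin x * n x))) in D1.
  change (is_derive (tail_integral (fun t => sin t * h' t - cos t * n t)) x
    (- (sin x * h' x - cos x * n x))) in D2.
  unfold duhamel, duhamel'.
  set (I1 := tail_integral (fun t => cos t * h' t + sin t * n t)) in *.
  set (I2 := tail_integral (fun t => sin t * h' t - cos t * n t)) in *.
  clearbody I1 I2.
  assert (P := sin2_cos2 x); unfold Rsqr in P.
  assert (V1 : Derive (fun y => I1 y) x = - (cos x * h' x + sin x * n x))
    by (apply is_derive_unique, D1).
  assert (V2 : Derive (fun y => I2 y) x = - (sin x * h' x - cos x * n x))
    by (apply is_derive_unique, D2).
  assert (V3 : Derive (fun y => h y) x = h' x) by (apply is_derive_unique, Hh, Hx).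
  split.
  - auto_derive.
    + repeat split; try (eexists; eauto).
          + rewrite V1, V2, V3.
      transitivity (h' x * (1 - (sin x * sin x + cos x * cos x)) + (- sin x * I1 x + cos x * I2 x)).
      * ring.
      * rewrite P; ring.
  - auto_derive.
    + repeat split; try (eexists; eauto).
    + rewrite V1, V2.
      transitivity (n x * (sin x * sin x + cos x * cos x) - (cos x * I1 x + sin x * I2 x)).
      * ring.
      * rewrite P; ring.
Qed.

Lemma tail_integral_minus (u v : R -> R) (x : R) :
  ex_tail_integral u x -> ex_tail_integral v x ->
  tail_integral u x - tail_integral v x = tail_integral (fun t => u t - v t) x.
Proof.
  intros [lu Hu] [lv Hv]; unfold tail_integral.
  rewrite (is_RInt_gen_unique u _ Hu), (is_RInt_gen_unique v _ Hv).
  symmetry; apply is_RInt_gen_unique.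
  apply (is_RInt_gen_minus (V := R_NormedModule) u v lu lv Hu Hv).
Qed.

Lemma tail_integral_ext (u v : R -> R) (x : R) :
  (forall t, x < t -> u t = v t) -> ex_tail_integral u x ->
  tail_integral u x = tail_integral v x.
Proof.
  intros H [l Hl]; unfold tail_integral.
  rewrite (is_RInt_gen_unique u _ Hl); symmetry; apply is_RInt_gen_unique.
  apply (is_RInt_gen_ext (V := R_NormedModule) u v l); [|exact Hl].
  apply (Filter_prod _ _ _ (fun y => y = x) (fun b => x < b));
    [reflexivity|exists x; auto|].
  simpl; intros y b -> Hb t Ht; rewrite Rmin_left in Ht by lra; apply H, Ht.
Qed.

(** 5 = 1 + 2 + 2: the boundary term [h], then the two tail integrals, each with the factor 2 of the
    tail of t^(-3/2). *)
Lemma duhamel_bound (S C : R) (M h h' : R -> R) (x : R) :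
  weight S M -> 0 <= C -> S < x ->
  (forall x, S < x -> continuous h' x) ->
  (forall x, S < x -> Rabs (h x) <= C * M x / sqrt x) ->
  (forall x, S < x -> Rabs (h' x) <= C * M x / (x * sqrt x)) ->
  Rabs (duhamel h h' (fun _ => 0) x) <= 5 * C * M x / sqrt x.
Proof.
  intros HM HC Hx Ch' Bh Bh'.
  destruct (tail_integral_comb S C M h' (fun _ => 0) x HM HC Hx Ch')
    as [[_ B1] [_ B2]].
  { intros; apply continuous_const. }
  { intros t Ht; rewrite Rabs_R0, Rplus_0_r; auto. }
  unfold duhamel; rewrite Rplus_assoc.
  replace (5 * C * M x / sqrt x)
    with (C * M x / sqrt x + (2 * C * M x / sqrt x + 2 * C * M x / sqrt x))
    by (unfold Rdiv; ring).
  apply Rle_trans with (1 := Rabs_triang _ _), Rplus_le_compat; [auto|].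
  apply Rle_trans with (1 := proj1 (Rabs_sin_cos_comb _ _ _)); lra.
Qed.

(** The terms in [h] and [h'] cancel in the difference, leaving two tail integrals of [n1 - n2],
    each costing the factor 2. The bounds with [C] and [D] serve only to make the separate integrals
    converge. *)
Lemma duhamel_contraction (S C D E : R) (M h h' n1 n2 : R -> R) (x : R) :
  weight S M -> 0 <= C -> 0 <= D -> 0 <= E -> S < x ->
  (forall x, S < x -> continuous h' x) ->
  (forall x, S < x -> continuous n1 x) -> (forall x, S < x -> continuous n2 x) ->
  (forall x, S < x -> Rabs (h' x) <= C * M x / (x * sqrt x)) ->
  (forall x, S < x -> Rabs (n1 x) <= D * M x / (x * sqrt x)) ->
  (forall x, S < x -> Rabs (n2 x) <= D * M x / (x * sqrt x)) ->
  (forall x, S < x -> Rabs (n1 x - n2 x) <= E * M x / (x * sqrt x)) ->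
  Rabs (duhamel h h' n1 x - duhamel h h' n2 x) <= 4 * E * M x / sqrt x.
Proof.
  intros HM HC HD HE Hx Ch' C1 C2 Bh' B1 B2 B12.
  assert (HB : forall n, (forall x, S < x -> Rabs (n x) <= D * M x / (x * sqrt x)) ->
     forall t, S < t -> Rabs (h' t) + Rabs (n t) <= (C + D) * M t / (t * sqrt t)).
  { intros n Hn t Ht; replace ((C + D) * M t / (t * sqrt t))
      with (C * M t / (t * sqrt t) + D * M t / (t * sqrt t)) by (unfold Rdiv; ring).
    apply Rplus_le_compat; auto. }
  destruct (tail_integral_comb S (C + D) M h' n1 x HM ltac:(lra) Hx Ch' C1 (HB n1 B1))
    as [[E11 _] [E12 _]].
  destruct (tail_integral_comb S (C + D) M h' n2 x HM ltac:(lra) Hx Ch' C2 (HB n2 B2))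
    as [[E21 _] [E22 _]].
  destruct (tail_integral_comb S E M (fun _ => 0) (fun t => n1 t - n2 t) x HM HE Hx)
    as [[F1 G1] [F2 G2]].
  { intros; apply continuous_const. }
  { intros; apply (continuous_minus (V := R_NormedModule)); auto. }
  { intros t Ht; rewrite Rabs_R0, Rplus_0_l; auto. }
  rewrite (tail_integral_ext _
    (fun t => (cos t * h' t + sin t * n1 t) - (cos t * h' t + sin t * n2 t)) x) in G1
    by (exact F1 || (intros; ring)).
  rewrite (tail_integral_ext _
    (fun t => (sin t * h' t - cos t * n1 t) - (sin t * h' t - cos t * n2 t)) x) in G2
    by (exact F2 || (intros; ring)).
  rewrite <- tail_integral_minus in G1, G2 by assumption.
  unfold duhamel.
  match goal with |- Rabs ?e <= _ => replace e with
   (cos x * (tail_integral (fun t => cos t * h' t + sin t * n1 t) x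
     - tail_integral (fun t => cos t * h' t + sin t * n2 t) x)
   + sin x * (tail_integral (fun t => sin t * h' t - cos t * n1 t) x
     - tail_integral (fun t => sin t * h' t - cos t * n2 t) x)) by ring end.
  replace (4 * E * M x / sqrt x)
    with (2 * E * M x / sqrt x + 2 * E * M x / sqrt x) by (unfold Rdiv; ring).
  apply Rle_trans with (1 := proj1 (Rabs_sin_cos_comb _ _ _)); lra.
Qed.

(** * Picard iteration with pointwise geometric convergence *)

Fixpoint picard (h h' : R -> R) (N : R -> R -> R) (k : nat) : R -> R :=
  match k with
  | O => fun _ => 0
  | S k => duhamel h h' (fun t => N t (picard h h' N k t))
  end.

Lemma Rle_all_half_pow (a b : R) : (forall k, a <= b * (/ 2) ^ k) -> a <= 0.
Proof.
  intros H.
  assert (L : is_lim_seq (fun k => b * (/ 2) ^ k) (Rbar_mult b 0)).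
  { apply is_lim_seq_scal_l, is_lim_seq_geom; rewrite Rabs_pos_eq; lra. }
  replace (Rbar_mult b 0) with (Finite 0) in L by (simpl; f_equal; ring).
  apply (is_lim_seq_le (fun _ => a) (fun k => b * (/ 2) ^ k) a 0 H); [|exact L].
  apply is_lim_seq_const.
Qed.

(* The bounds are pointwise in [a], [b], so that [b = 0] at some points is harmless. *)
Lemma geometric_limit (a : nat -> R) (b : R) :
  (forall k, Rabs (a (S k) - a k) <= b * (/ 2) ^ k) ->
  forall k, Rabs (real (Lim_seq a) - a k) <= 2 * b * (/ 2) ^ k.
Proof.
  intros H.
  assert (Hb : 0 <= b).
  { generalize (H O); simpl; generalize (Rabs_pos (a 1%nat - a O)); lra. }
  assert (Hp : forall k, 0 < (/ 2) ^ k) by (intros; apply pow_lt; lra).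
  (* Keeping the exact partial sum of the geometric series is what lets the induction on [j]
     close. *)
  assert (T : forall j k, Rabs (a (k + j)%nat - a k) <= 2 * b * ((/ 2) ^ k - (/ 2) ^ (k + j))).
  { induction j; intros k.
    - rewrite Nat.add_0_r, !Rminus_diag, Rabs_R0; lra.
    - replace (a (k + S j)%nat - a k)
        with ((a (S (k + j)) - a (k + j)%nat) + (a (k + j)%nat - a k))
        by (rewrite Nat.add_succ_r; ring).
      apply Rle_trans with (1 := Rabs_triang _ _).
      generalize (H (k + j)%nat) (IHj k); rewrite Nat.add_succ_r; simpl; lra. }
  assert (T' : forall j k, Rabs (a (k + j)%nat - a k) <= 2 * b * (/ 2) ^ k).
  { intros j k; apply Rle_trans with (1 := T j k).
    generalize (Hp (k + j)%nat); nra. }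
  assert (F : ex_finite_lim_seq a).
  { apply ex_lim_seq_cauchy_corr; intros eps.
    assert (L : is_lim_seq (fun k => 4 * b * (/ 2) ^ k) (Rbar_mult (4 * b) 0)).
    { apply is_lim_seq_scal_l, is_lim_seq_geom; rewrite Rabs_pos_eq; lra. }
    replace (Rbar_mult (4 * b) 0) with (Finite 0) in L by (simpl; f_equal; ring).
    apply is_lim_seq_spec in L; destruct (L eps) as [n0 Hn0].
    exists n0; intros n m Hn Hm.
    assert (B := Hn0 n0 (le_n _)).
    assert (Hb4 : 0 <= 4 * b * (/ 2) ^ n0) by (generalize (Hp n0); nra).
    rewrite Rminus_0_r, Rabs_pos_eq in B by exact Hb4.
    replace n with (n0 + (n - n0))%nat by lia.
    replace m with (n0 + (m - n0))%nat by lia.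
    generalize (T' (n - n0)%nat n0) (T' (m - n0)%nat n0); intros T1 T2.
    replace (a (n0 + (n - n0))%nat - a (n0 + (m - n0))%nat) with
      ((a (n0 + (n - n0))%nat - a n0) + - (a (n0 + (m - n0))%nat - a n0)) by ring.
    apply Rle_lt_trans with (1 := Rabs_triang _ _); rewrite Rabs_Ropp; lra. }
  destruct F as [l Hl]; rewrite (is_lim_seq_unique _ _ Hl); simpl; intros k.
  apply (is_lim_seq_le (fun j => Rabs (a (j + k)%nat - a k)) (fun _ => 2 * b * (/ 2) ^ k)
    (Rabs (l - a k)) (2 * b * (/ 2) ^ k)).
  - intros j; rewrite Nat.add_comm; apply T'.
  - apply (is_lim_seq_abs (fun j => a (j + k)%nat - a k) (l - a k)).
    apply is_lim_seq_minus'; [|apply is_lim_seq_const].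
    apply (is_lim_seq_incr_n a k), Hl.
  - apply is_lim_seq_const.
Qed.

Lemma continuous_of_uniform_approx (q : R -> R) (qk : nat -> R -> R) (b x : R) :
  (forall k, continuous (qk k) x) ->
  locally x (fun y => forall k, Rabs (q y - qk k y) <= b * (/ 2) ^ k) ->
  continuous q x.
Proof.
  intros Hc Ha; apply filterlim_locally; intros eps.
  assert (L : is_lim_seq (fun k => b * (/ 2) ^ k) (Rbar_mult b 0)).
  { apply is_lim_seq_scal_l, is_lim_seq_geom; rewrite Rabs_pos_eq; lra. }
  replace (Rbar_mult b 0) with (Finite 0) in L by (simpl; f_equal; ring).
  apply is_lim_seq_spec in L.
  assert (e3 : 0 < eps / 3) by (generalize (cond_pos eps); lra).
  destruct (L (mkposreal _ e3)) as [k Hk].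
  assert (B := Hk k (le_n _)); simpl in B; rewrite Rminus_0_r in B.
  assert (B' := Rle_lt_trans _ _ _ (Rle_abs _) B).
  assert (Hck := proj1 (filterlim_locally _ _) (Hc k) (mkposreal _ e3)).
  assert (Hax := locally_singleton _ _ Ha k).
  generalize (filter_and _ _ Ha Hck); apply filter_imp; intros y [Hy1 Hy2].
  specialize (Hy1 k).
  change (Rabs (qk k y - qk k x) < eps / 3) in Hy2.
  change (Rabs (q y - q x) < eps).
  replace (q y - q x) with ((q y - qk k y) + ((qk k y - qk k x) + - (q x - qk k x))) by ring.
  apply Rle_lt_trans with (1 := Rabs_triang _ _).
  generalize (Rabs_triang (qk k y - qk k x) (- (q x - qk k x))); rewrite Rabs_Ropp; lra.
Qed.

(* The first Picard iterate is at most 5 C M x / sqrt x; the Lipschitz constant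
   1/(8 x) of N makes each increment at most half the previous one, whence 10 C. *)
Lemma forced_oscillator (S C : R) (M h h' : R -> R) (N : R -> R -> R) :
  weight S M -> 0 <= C ->
  (forall x, S < x -> is_derive h x (h' x)) ->
  (forall x, S < x -> continuous h' x) ->
  (forall x, S < x -> Rabs (h x) <= C * M x / sqrt x) ->
  (forall x, S < x -> Rabs (h' x) <= C * M x / (x * sqrt x)) ->
  (forall x, S < x -> N x 0 = 0) ->
  (forall x p q, S < x -> Rabs p <= 10 * C * M x / sqrt x ->
     Rabs q <= 10 * C * M x / sqrt x -> Rabs (N x p - N x q) <= Rabs (p - q) / (8 * x)) ->
  (forall q, (forall x, S < x -> continuous q x) ->
     (forall x, S < x -> Rabs (q x) <= 10 * C * M x / sqrt x) ->
     forall x, S < x -> continuous (fun x => N x (q x)) x) ->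
  exists q q' : R -> R, forall x, S < x ->
    is_derive q x (q' x) /\ is_derive q' x (h x + N x (q x) - q x) /\
    Rabs (q x) <= 10 * C * M x / sqrt x.
Proof.
  intros HM HC Dh Ch' Bh Bh' N0 NL NC.
  set (qk := picard h h' N).
  set (W := fun x => M x / sqrt x).
  assert (HS : 0 <= S) by apply HM.
  assert (HW : forall x, S < x -> 0 <= C * W x).
  { intros x Hx; generalize (proj1 (Rdiv_weight_pos S C M x HM HC Hx)).
    unfold W, Rdiv; lra. }
  assert (E0 : forall a x, a * M x / sqrt x = a * W x)
    by (intros; unfold W, Rdiv; ring).
  assert (E1 : forall a x, S < x -> a * W x / (8 * x) = a / 8 * M x / (x * sqrt x)).
  { intros a x Hx; unfold W; field; split; [|lra].
    apply Rgt_not_eq, sqrt_lt_R0; lra. }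
  (* As [N x 0 = 0], the Lipschitz bound also bounds [N] itself, by 10 C / 8 <= 2 C times the
     integrable weight. *)
  assert (NB : forall q x, S < x -> Rabs q <= 10 * C * W x ->
     Rabs (N x q) <= 2 * C * M x / (x * sqrt x)).
  { intros q x Hx Hq.
    replace (N x q) with (N x q - N x 0) by (rewrite (N0 x Hx); ring).
    apply Rle_trans with (Rabs (q - 0) / (8 * x)).
    - apply NL; [exact Hx| |]; rewrite E0; [exact Hq|].
      rewrite Rabs_R0; generalize (HW x Hx); lra.
    - rewrite Rminus_0_r.
      apply Rle_trans with (10 * C * W x / (8 * x)).
      + apply Rmult_le_compat_r; [|exact Hq].
        apply Rlt_le, Rinv_0_lt_compat; lra.
      + rewrite E1 by exact Hx.
        generalize (proj2 (Rdiv_weight_pos S C M x HM HC Hx)); unfold Rdiv; lra. }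
  assert (HT : forall p q b, 0 <= b ->
     (forall x, S < x -> continuous p x) -> (forall x, S < x -> continuous q x) ->
     (forall x, S < x -> Rabs (p x) <= 10 * C * W x) ->
     (forall x, S < x -> Rabs (q x) <= 10 * C * W x) ->
     (forall x, S < x -> Rabs (p x - q x) <= b * W x) ->
     forall x, S < x -> Rabs (duhamel h h' (fun t => N t (p t)) x
        - duhamel h h' (fun t => N t (q t)) x) <= b / 2 * W x).
  { intros p q b Hb Cp Cq Bp Bq Bpq x Hx.
    (* The Lipschitz constant 1/(8 x) gives b/8, and the factor 4 of [duhamel_contraction] turns it
       into a contraction by one half. *)
    rewrite <- E0; replace (b / 2) with (4 * (b / 8)) by field.
    apply (duhamel_contraction S C (2 * C)); auto; try lra.
    - apply NC; auto. intros; rewrite E0; auto.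
    - apply NC; auto. intros; rewrite E0; auto.
    - intros y Hy; rewrite <- E1 by exact Hy.
      apply Rle_trans with (Rabs (p y - q y) / (8 * y)).
      + apply NL; rewrite ?E0; auto.
      + apply Rmult_le_compat_r; [|auto].
        apply Rlt_le, Rinv_0_lt_compat; lra. }
  assert (HD : forall q, (forall x, S < x -> continuous q x) ->
     (forall x, S < x -> Rabs (q x) <= 10 * C * W x) ->
     forall x, S < x ->
     is_derive (duhamel h h' (fun t => N t (q t))) x (duhamel' h' (fun t => N t (q t)) x) /\
     is_derive (duhamel' h' (fun t => N t (q t))) x
       (h x + N x (q x) - duhamel h h' (fun t => N t (q t)) x)).
  { intros q Cq Bq; apply (is_derive_duhamel S C (2 * C) M); auto; try lra.
    apply NC; auto. intros; rewrite E0; auto. }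
  assert (Hp : forall k, 0 < (/ 2) ^ k) by (intros; apply pow_lt; lra).
  (* The size bound is the partial sum 10 C (1 - 2^(-k)) of the increments 5 C 2^(-k), so every
     iterate stays in the range where [N] is Lipschitz. *)
  assert (I : forall k, (forall x, S < x -> continuous (qk k) x) /\
     (forall x, S < x -> continuous (qk (Datatypes.S k)) x) /\
     (forall x, S < x -> Rabs (qk k x) <= 10 * C * (1 - (/ 2) ^ k) * W x) /\
     (forall x, S < x -> Rabs (qk (Datatypes.S k) x - qk k x) <= 5 * C * (/ 2) ^ k * W x)).
  { assert (CD : forall q, (forall x, S < x -> continuous q x) ->
     (forall x, S < x -> Rabs (q x) <= 10 * C * W x) ->
     forall x, S < x -> continuous (duhamel h h' (fun t => N t (q t))) x).
    { intros q Cq Bq x Hx; apply (ex_derive_continuous (V := R_NormedModule)).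
      eexists; apply (HD q Cq Bq x Hx). }
    induction k as [|k (I1 & I2 & I3 & I4)].
    - assert (C0 : forall x, S < x -> continuous (qk O) x)
        by (intros; apply continuous_const).
      repeat split; auto.
      + apply (CD (qk O)); auto; intros x Hx; unfold qk; simpl; rewrite Rabs_R0.
        generalize (HW x Hx); lra.
      + intros x Hx; unfold qk; simpl; rewrite Rabs_R0; right; ring.
      + intros x Hx; unfold qk; simpl; rewrite Rminus_0_r.
        assert (T := duhamel_bound S C M h h' x HM HC Hx Ch' Bh Bh').
        rewrite E0 in T; rewrite Rmult_1_r.
        (* Needed only for the existence of the integrals: the first iterate has [N t 0] where
           [duhamel_bound] has the literal 0, and [tail_integral_ext] asks for convergence. *)
        assert (E := fun P Q => tail_integral_comb S (C + 2 * C) M h' (fun t => N t 0) x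
          HM ltac:(lra) Hx Ch' P Q).
        specialize (E ltac:(apply (NC (fun _ => 0)); [intros; apply continuous_const|];
          intros; cbv beta; rewrite Rabs_R0; apply Rdiv_weight_pos with S; auto; lra)).
        specialize (E ltac:(intros t Ht; cbv beta; rewrite N0, Rabs_R0, Rplus_0_r by exact Ht;
          apply Rle_trans with (1 := Bh' t Ht);
          generalize (proj2 (Rdiv_weight_pos S C M t HM HC Ht)); unfold Rdiv; lra)).
        apply Rle_trans with (2 := T); right; f_equal.
        unfold duhamel; f_equal; [f_equal|]; f_equal.
        * apply tail_integral_ext;
            [intros t Ht; rewrite N0 by lra; reflexivity|apply E].
        * apply tail_integral_ext;
            [intros t Ht; rewrite N0 by lra; reflexivity|apply E].
    - assert (J3 : forall x, S < x ->
        Rabs (qk (Datatypes.S k) x) <= 10 * C * (1 - (/ 2) ^ (Datatypes.S k)) * W x).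
      { intros x Hx.
        replace (qk (Datatypes.S k) x) with ((qk (Datatypes.S k) x - qk k x) + qk k x) by ring.
        apply Rle_trans with (1 := Rabs_triang _ _).
        generalize (I3 x Hx) (I4 x Hx); simpl; lra. }
      assert (K : forall j x, S < x -> Rabs (qk j x) <= 10 * C * (1 - (/ 2) ^ j) * W x ->
         Rabs (qk j x) <= 10 * C * W x).
      { intros j x Hx Hj; apply Rle_trans with (1 := Hj).
        generalize (HW x Hx) (Hp j); nra. }
      repeat split; auto.
      + apply (CD (qk (Datatypes.S k))); auto.
      + intros x Hx.
        replace (5 * C * (/ 2) ^ Datatypes.S k * W x)
          with (5 * C * (/ 2) ^ k / 2 * W x) by (simpl; field).
        apply (HT (qk (Datatypes.S k)) (qk k)); auto.
        generalize (Hp k); nra. }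
  set (q := fun x => real (Lim_seq (fun k => qk k x))).
  assert (Bq : forall x, S < x -> forall k, Rabs (q x - qk k x) <= 10 * C * W x * (/ 2) ^ k).
  { intros x Hx k; replace (10 * C * W x) with (2 * (5 * C * W x)) by ring.
    apply (geometric_limit (fun k => qk k x)); intros j.
    replace (5 * C * W x * (/ 2) ^ j) with (5 * C * (/ 2) ^ j * W x) by ring.
    apply I, Hx. }
  assert (Bq0 : forall x, S < x -> Rabs (q x) <= 10 * C * W x).
  { intros x Hx; generalize (Bq x Hx O); simpl; rewrite Rminus_0_r, Rmult_1_r; auto. }
  assert (Cq : forall x, S < x -> continuous q x).
  { intros x Hx.
    (* [W] is nonincreasing, so [W y] makes the convergence uniform to the right of [y], a
       neighbourhood of [x]. *)
    set (y := (S + x) / 2); assert (Hy : S < y < x) by (unfold y; lra).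
    apply (continuous_of_uniform_approx q qk (10 * C * W y) x); auto.
    - intros k; apply I, Hx.
    - generalize (locally_gt y x (proj2 Hy)); apply filter_imp; intros z Hz k.
      apply Rle_trans with (1 := Bq z ltac:(lra) k).
      apply Rmult_le_compat_r; [apply Rlt_le, Hp|].
      apply Rmult_le_compat_l; [lra|].
      unfold W; apply Rmult_le_compat.
      + apply HM; lra.
      + apply Rlt_le, Rinv_0_lt_compat, sqrt_lt_R0; lra.
      + apply HM; lra.
      + apply Rinv_le_contravar; [apply sqrt_lt_R0; lra|apply sqrt_le_1; lra]. }
  (* Both sides lie within a multiple of 2^(-k) of the iterate of index k + 1. Once [q] equals its
     Duhamel integral, [HD] differentiates it twice, so the derivatives of the iterates need not
     converge. *)
  assert (Fix : forall x, S < x -> duhamel h h' (fun t => N t (q t)) x = q x).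
  { intros x Hx; apply Rminus_diag_uniq; 
      apply Rabs_eq_0; apply Rle_antisym; [|apply Rabs_pos].
    apply Rle_all_half_pow with (10 * C * W x); intros k.
    replace (duhamel h h' (fun t => N t (q t)) x - q x) with
      ((duhamel h h' (fun t => N t (q t)) x - qk (Datatypes.S k) x)
        + - (q x - qk (Datatypes.S k) x)) by ring.
    apply Rle_trans with (1 := Rabs_triang _ _); rewrite Rabs_Ropp.
    assert (T1 := Bq x Hx (Datatypes.S k)).
    assert (T2 := HT q (qk k) (10 * C * (/ 2) ^ k)).
    assert (T3 := T2 ltac:(generalize (Hp k); nra) Cq (proj1 (I k)) Bq0).
    assert (T4 : Rabs (duhamel h h' (fun t => N t (q t)) x - qk (Datatypes.S k) x)
      <= 10 * C * (/ 2) ^ k / 2 * W x).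
    { apply T3; [| |exact Hx].
      - intros z Hz; apply Rle_trans with (1 := proj1 (proj2 (proj2 (I k))) z Hz).
        generalize (HW z Hz) (Hp k); nra.
      - intros z Hz; replace (10 * C * (/ 2) ^ k * W z)
          with (10 * C * W z * (/ 2) ^ k) by ring. apply Bq, Hz. }
    simpl in T1; simpl; lra. }
  exists q, (duhamel' h' (fun t => N t (q t))); intros x Hx.
  destruct (HD q Cq Bq0 x Hx) as [D1 D2].
  rewrite (Fix x Hx) in D2.
  split; [|split; [exact D2|rewrite E0; auto]].
  apply is_derive_ext_loc with (2 := D1).
  generalize (locally_gt S x Hx); apply filter_imp; auto.
Qed.

(** * Model nonlinearity *)

(* In the variable t = log(1/|x|^2), G(v(x)) = model_G B t for every B >= 1. *)
Definition model_G (B t : R) : R := B / 4 * (t + 1) * exp (- t).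

(* The inverse of t |-> v, and the constant in dt/ds = t^(1/B) / model_k B. *)
Definition model_t (B s : R) : R :=
  if Req_EM_T B 1 then exp s else Rpower s (conj_exp B).

Definition model_k (B : R) : R := if Req_EM_T B 1 then 1 else / conj_exp B.

Lemma model_k_pos (B : R) : 1 <= B -> 0 < model_k B.
Proof.
  intros HB; unfold model_k, conj_exp; destruct (Req_EM_T B 1) as [E|E]; [lra|].
  apply Rinv_0_lt_compat, Rdiv_lt_0_compat; lra.
Qed.

Lemma model_t_pos (B s : R) : 0 < model_t B s.
Proof.
  unfold model_t; destruct (Req_EM_T B 1); [apply exp_pos|].
  unfold Rpower; apply exp_pos.
Qed.

Lemma is_derive_Rpower_l (a s : R) : 0 < s ->
  is_derive (fun s => Rpower s a) s (a / s * Rpower s a).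
Proof.
  intros Hs; unfold Rpower; auto_derive; [exact Hs|].
  field; lra.
Qed.

(** For B > 1, dt/ds = B' s^(B'-1) and B' - 1 = B'/B; for B = 1, t = e^s is its own derivative. This
    common form lets the two models be treated together from here on. *)
Lemma is_derive_model_t (B s : R) : 1 <= B -> 0 < s ->
  is_derive (model_t B) s (Rpower (model_t B s) (/ B) / model_k B).
Proof.
  intros HB Hs; unfold model_t, model_k; destruct (Req_EM_T B 1) as [E|E].
  - subst B; rewrite Rinv_1, Rpower_1 by apply exp_pos.
    auto_derive; [exact I|field].
  - assert (HB1 : B - 1 <> 0) by lra.
    evar_last; [apply is_derive_Rpower_l, Hs|].
    rewrite Rpower_mult.
    replace (conj_exp B * / B) with (conj_exp B + - (1))
      by (unfold conj_exp; field; split; lra).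
    rewrite Rpower_plus, Rpower_Ropp, Rpower_1 by exact Hs.
    unfold conj_exp; field; repeat split; lra.
Qed.

(** The form forced by -1/g = (dG/dt)(dt/ds), with dG/dt = -(B/4) t e^(-t) and dt/ds = t^(1/B) /
    [model_k B]. *)
Lemma model_g_eq (B s : R) : 1 <= B -> 0 < s ->
  model_g B s =
    4 * model_k B / B * Rpower (model_t B s) (-1 - / B) * exp (model_t B s).
Proof.
  intros HB Hs; unfold model_g, model_k, model_t; destruct (Req_EM_T B 1) as [E|E].
  - subst B; rewrite Rinv_1; replace (-1 - 1) with (- (2)) by ring.
    rewrite Rpower_Ropp.
    replace (Rpower (exp s) 2) with (exp (2 * s))
      by (unfold Rpower; rewrite ln_exp; reflexivity).
    field; apply Rgt_not_eq, exp_pos.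
  - assert (HB1 : B - 1 <> 0) by lra.
    rewrite Rpower_mult.
    replace (conj_exp B * (-1 - / B)) with (1 - 2 * conj_exp B)
      by (unfold conj_exp; field; split; lra).
    unfold conj_exp; field; repeat split; lra.
Qed.

Lemma model_g_pos (B s : R) : 1 <= B -> 0 < s -> 0 < model_g B s.
Proof.
  intros HB Hs; rewrite model_g_eq by assumption.
  assert (H := model_k_pos B HB).
  repeat apply Rmult_lt_0_compat; try lra.
  - apply Rinv_0_lt_compat; lra.
  - unfold Rpower; apply exp_pos.
  - apply exp_pos.
Qed.

Lemma is_derive_model_G (B t : R) :
  is_derive (model_G B) t (- (B / 4 * t * exp (- t))).
Proof. unfold model_G; auto_derive; [exact I|field]. Qed.

Lemma filterlim_mult_exp_opp :
  filterlim (fun t => t * exp (- t)) (Rbar_locally p_infty) (locally 0).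
Proof.
  apply (is_lim_ext_loc (fun t => / (exp t / t)) _ p_infty 0).
  { exists 0; intros t Ht; rewrite exp_Ropp; field; split; [|lra].
    apply Rgt_not_eq, exp_pos. }
  apply (is_lim_inv (fun t => exp t / t) p_infty p_infty); [|discriminate].
  apply is_lim_div_exp_p.
Qed.

Lemma filterlim_model_G (B : R) :
  filterlim (model_G B) (Rbar_locally p_infty) (locally 0).
Proof.
  apply (is_lim_ext (fun t => B / 4 * (t * exp (- t) + exp (- t))) _ p_infty 0).
  { intros t; unfold model_G; ring. }
  replace (Finite 0) with (Rbar_mult (B / 4) (0 + 0))
    by (simpl; f_equal; ring).
  apply is_lim_scal_l, is_lim_plus'.
  - apply filterlim_mult_exp_opp.
  - apply (is_lim_comp exp Ropp p_infty 0 m_infty).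
    + apply is_lim_exp_m.
    + apply (is_lim_opp (fun x => x) p_infty p_infty), is_lim_id.
    + exists 0; intros; discriminate.
Qed.

Lemma filterlim_model_t (B : R) : 1 <= B ->
  filterlim (model_t B) (Rbar_locally p_infty) (Rbar_locally p_infty).
Proof.
  intros HB; unfold model_t; destruct (Req_EM_T B 1) as [E|E].
  - apply is_lim_exp_p.
  - unfold Rpower.
    apply (is_lim_comp exp (fun s => conj_exp B * ln s) p_infty p_infty p_infty).
    + apply is_lim_exp_p.
    + assert (Hc : 0 < conj_exp B) by (apply Rdiv_lt_0_compat; lra).
      assert (Hl := is_lim_scal_l ln (conj_exp B) p_infty p_infty is_lim_ln_p).
      replace (Rbar_mult (conj_exp B) p_infty) with p_infty in Hl; [exact Hl|].
      symmetry; apply is_Rbar_mult_unique, is_Rbar_mult_sym, is_Rbar_mult_p_infty_pos.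
      exact Hc.
    + exists 0; intros; discriminate.
Qed.

Lemma Rpower_model (t B : R) : 0 < t -> 1 <= B ->
  Rpower t (-1 - / B) = / (t * Rpower t (/ B)).
Proof.
  intros Ht HB; replace (-1 - / B) with (- (1 + / B)) by ring.
  rewrite Rpower_Ropp, Rpower_plus, Rpower_1 by exact Ht; reflexivity.
Qed.

Lemma tail_model_g (B s : R) : 1 <= B -> 0 < s ->
  tail (model_g B) s = model_G B (model_t B s).
Proof.
  intros HB Hs; unfold tail; apply is_RInt_gen_unique.
  replace (model_G B (model_t B s)) with (- - model_G B (model_t B s)) by ring.
  assert (Hd : forall x, 0 < x ->
    is_derive (fun s => - model_G B (model_t B s)) x (/ model_g B x)).
  { intros x Hx.
    assert (Hk := model_k_pos B HB). assert (Ht := model_t_pos B x).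
    assert (Hp : 0 < Rpower (model_t B x) (/ B)) by (unfold Rpower; apply exp_pos).
    assert (He := exp_pos (model_t B x)).
    evar_last.
    - apply (is_derive_opp (V := R_NormedModule)).
      apply (is_derive_comp (V := R_NormedModule) (model_G B) (model_t B)).
      + apply is_derive_model_G.
      + apply is_derive_model_t; assumption.
    - rewrite model_g_eq, Rpower_model, exp_Ropp by (assumption || lra).
      unfold opp, scal; simpl; unfold mult; simpl; field.
      repeat split; lra. }
  apply (is_RInt_gen_antiderivative (fun s => - model_G B (model_t B s)) _ 0); auto.
  - intros x Hx.
    assert (Hg := model_g_pos B x HB Hx).
    apply (continuous_ext_loc _ (fun s => / (4 * model_k B / B
      * Rpower (model_t B s) (-1 - / B) * exp (model_t B s)))).
    { generalize (locally_gt 0 x Hx); apply filter_imp; intros y Hy.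
      rewrite model_g_eq by assumption; reflexivity. }
    rewrite model_g_eq in Hg by assumption.
    apply (ex_derive_continuous (V := R_NormedModule)).
    unfold Rpower; unfold Rpower in Hg; auto_derive.
    assert (Hd' := is_derive_model_t B x HB Hx).
    repeat split; try (eexists; exact Hd'); [apply model_t_pos|lra].
  - replace 0 with (- 0) by ring.
    apply (is_lim_opp (fun s => model_G B (model_t B s)) p_infty 0).
    apply (filterlim_comp _ _ _ (model_t B) (model_G B) _ (Rbar_locally p_infty)).
    + apply filterlim_model_t, HB.
    + apply filterlim_model_G.
Qed.

(** The power t^(1/B) in dt/ds cancels the one in g, so that g'G is rational in t. *)
Lemma is_derive_model_g (B s : R) : 1 <= B -> 0 < s ->
  let t := model_t B s in
  is_derive (model_g B) s (4 / B * exp t * (t - (1 + / B)) / t ^ 2).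
Proof.
  intros HB Hs t.
  apply is_derive_ext_loc with (fun s => 4 * model_k B / B
      * Rpower (model_t B s) (-1 - / B) * exp (model_t B s)).
  { generalize (locally_gt 0 s Hs); apply filter_imp; intros y Hy.
    rewrite model_g_eq by assumption; reflexivity. }
  assert (Hk := model_k_pos B HB). assert (Ht := model_t_pos B s).
  assert (Hp : 0 < Rpower (model_t B s) (/ B)) by (unfold Rpower; apply exp_pos).
  evar_last.
  - apply (is_derive_comp (V := R_NormedModule)
      (fun t => 4 * model_k B / B * Rpower t (-1 - / B) * exp t) (model_t B)).
    + apply (is_derive_mult (fun t => 4 * model_k B / B * Rpower t (-1 - / B)) exp).
      * apply (is_derive_scal (fun t => Rpower t (-1 - / B))), is_derive_Rpower_l, Ht.
      * apply is_derive_exp.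
      * intros; apply Rmult_comm.
    + apply is_derive_model_t; assumption.
  - fold t in Hp, Ht |- *; rewrite Rpower_model by assumption.
    unfold scal, plus, mult; simpl; unfold mult, plus; simpl.
    field; repeat split; lra.
Qed.

Lemma is_derive_2_model_g (B s : R) : 1 <= B -> 0 < s ->
  let t := model_t B s in
  Derive_n (model_g B) 2 s = 4 / B * (Rpower t (/ B) / model_k B) * exp t
    * (t ^ 2 - (2 + / B) * t + 2 * (1 + / B)) / t ^ 3.
Proof.
  intros HB Hs t; simpl.
  apply is_derive_unique.
  apply is_derive_ext_loc with (fun s => 4 / B * exp (model_t B s) *
     (model_t B s - (1 + / B)) / model_t B s ^ 2).
  { generalize (locally_gt 0 s Hs); apply filter_imp; intros y Hy.
    symmetry; apply is_derive_unique, is_derive_model_g; assumption. }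
  assert (Hk := model_k_pos B HB). assert (Ht := model_t_pos B s).
  evar_last.
  - apply (is_derive_comp (V := R_NormedModule)
      (fun t => 4 / B * exp t * (t - (1 + / B)) / t ^ 2) (model_t B)).
    + auto_derive; [|reflexivity]. 
      apply Rgt_not_eq. simpl; nra.
    + apply is_derive_model_t; assumption.
  - fold t in Ht |- *.
    unfold scal; simpl; unfold mult; simpl.
    field; repeat split; lra.
Qed.

Lemma recip_B1_model_g (B s : R) : 1 <= B -> 0 < s ->
  let t := model_t B s in
  recip_B1 (model_g B) s = - ln (model_G B t) * ((1 + (t + 1) / B) / t ^ 2).
Proof.
  intros HB Hs t; unfold recip_B1.
  rewrite tail_model_g by assumption; fold t.
  rewrite (is_derive_unique _ _ _ (is_derive_model_g B s HB Hs)); fold t.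
  assert (Ht : 0 < t) by apply model_t_pos.
  f_equal; unfold model_G; rewrite exp_Ropp.
  field; repeat split; try lra; apply Rgt_not_eq, exp_pos.
Qed.

(** The condition 1 + 1/B < t makes g' positive, so the division by g' inside 1/B_2 is
    legitimate. *)
Lemma recip_B2_model_g (B s : R) : 1 <= B -> 0 < s ->
  let t := model_t B s in
  1 + / B < t ->
  recip_B2 (model_g B) s =
    ln (model_G B t) ^ 2 * ((t + 1) * (t / B + 2 + 2 / B) / t ^ 4).
Proof.
  intros HB Hs t Ht1; unfold recip_B2.
  rewrite tail_model_g by assumption.
  rewrite is_derive_2_model_g, model_g_eq by assumption.
  rewrite (is_derive_unique _ _ _ (is_derive_model_g B s HB Hs)); fold t.
  assert (Ht : 0 < t) by apply model_t_pos.
  rewrite Rpower_model by assumption.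
  assert (Hk := model_k_pos B HB).
  assert (Hp : 0 < Rpower t (/ B)) by (unfold Rpower; apply exp_pos).
  assert (HtB : B * t - (B + 1) > 0).
  { apply (Rmult_lt_compat_l B) in Ht1; [|lra].
    rewrite Rmult_plus_distr_l, Rinv_r in Ht1 by lra; lra. }
  set (L := ln (model_G B t)); unfold model_G; rewrite exp_Ropp.
  assert (He := exp_pos t).
  field; repeat split; lra.
Qed.

Lemma model_t_model_v (B : R) (x : R * R) : 1 <= B ->
  1 < ln (1 / enorm x ^ 2) ->
  0 < model_v B x /\ model_t B (model_v B x) = ln (1 / enorm x ^ 2).
Proof.
  intros HB Ht; unfold model_v, model_t; destruct (Req_EM_T B 1) as [E|E].
  - split; [|apply exp_ln; lra].
    rewrite <- ln_1; apply ln_increasing; lra.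
  - split; [unfold Rpower; apply exp_pos|].
    rewrite Rpower_mult.
    replace (1 / conj_exp B * conj_exp B) with 1
      by (unfold conj_exp; field; split; lra).
    apply Rpower_1; lra.
Qed.

(** * Tail integral and its inverse *)

Lemma cond_f1_derive (s0 : R) (f : R -> R) (s : R) : cond_f1 s0 f -> s0 < s ->
  is_derive f s (Derive f s) /\
  is_derive (Derive f) s (Derive_n f 2 s) /\
  continuous (Derive_n f 2) s.
Proof.
  intros [_ H] Hs; destruct (H s Hs) as (Hk & _).
  split; [|split].
  - apply Derive_correct, (proj1 (Hk 1%nat ltac:(lia))).
  - apply (Derive_correct (Derive f)), (proj1 (Hk 2%nat ltac:(lia))).
  - apply (Hk 2%nat ltac:(lia)).
Qed.

Lemma cond_f1_continuous (s0 : R) (f : R -> R) (s : R) : cond_f1 s0 f -> s0 < s ->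
  continuous f s.
Proof.
  intros H Hs; apply (ex_derive_continuous (V := R_NormedModule)).
  eexists; apply (cond_f1_derive s0 f s H Hs).
Qed.

Lemma cond_f1_continuous_inv (s0 : R) (f : R -> R) (s : R) : cond_f1 s0 f -> s0 < s ->
  continuous (fun t => / f t) s.
Proof.
  intros H Hs; assert (D := proj1 (cond_f1_derive s0 f s H Hs)).
  apply (ex_derive_continuous (V := R_NormedModule)).
  auto_derive; split; [eexists; exact D|]; split; [|exact I].
  destruct H as [_ H]; destruct (H s Hs) as (_ & P & _); lra.
Qed.

Lemma is_derive_tail (s0 : R) (f : R -> R) (s : R) : cond_f1 s0 f -> s0 < s ->
  is_derive (tail f) s (- / f s).
Proof.
  intros H Hs; apply (is_derive_RInt_gen (fun t => / f t) s0); [|exact Hs|].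
  - intros t Ht; apply (cond_f1_continuous_inv s0 f t H Ht).
  - destruct H as [_ H]; destruct (H s Hs) as (_ & _ & _ & E); exact E.
Qed.

Lemma filterlim_tail (s0 : R) (f : R -> R) : cond_f1 s0 f ->
  filterlim (tail f) (Rbar_locally p_infty) (locally 0).
Proof.
  intros H; apply (filterlim_RInt_gen_0 (fun t => / f t) s0 (s0 + 1)); [|lra|].
  - intros t Ht; apply (cond_f1_continuous_inv s0 f t H Ht).
  - destruct H as [_ H]; destruct (H (s0 + 1) ltac:(lra)) as (_ & _ & _ & E); exact E.
Qed.

Lemma tail_decreasing (s0 : R) (f : R -> R) (s t : R) : cond_f1 s0 f -> s0 < s -> s < t ->
  tail f t < tail f s.
Proof.
  intros H Hs Ht.
  assert (H' := H); destruct H' as [_ Hp].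
  cut (- tail f s < - tail f t); [lra|].
  apply (incr_function_le (fun s => - tail f s) s t (fun s => / f s)); simpl; try lra.
  - intros x Hx _.
    evar_last; [apply (is_derive_opp (V := R_NormedModule)), (is_derive_tail s0 f x H); lra|].
    unfold opp; simpl; ring.
  - intros x Hx _; apply Rinv_0_lt_compat, (Hp x ltac:(lra)).
Qed.

Lemma tail_pos (s0 : R) (f : R -> R) (s : R) : cond_f1 s0 f -> s0 < s -> 0 < tail f s.
Proof.
  intros H Hs.
  apply Rle_lt_trans with (tail f (s + 1)).
  - apply (is_lim_le_loc (tail f) (fun _ => tail f (s + 1)) p_infty 0 (tail f (s + 1))).
    + exists (s + 1); intros x Hx; apply Rlt_le, (tail_decreasing s0 f); auto; lra.
    + apply (filterlim_tail s0 f H).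
    + apply is_lim_const.
  - apply (tail_decreasing s0 f); auto; lra.
Qed.

Lemma tail_inv_tail (s0 : R) (f : R -> R) (s : R) : cond_f1 s0 f -> s0 < s ->
  tail_inv s0 f (tail f s) = s.
Proof.
  intros H Hs; unfold tail_inv.
  apply (iota_unique (V := R_CompleteNormedModule)); [|auto].
  intros y [Hy E]; destruct (Rtotal_order y s) as [L|[L|L]]; [|exact L|].
  - generalize (tail_decreasing s0 f y s H Hy L); lra.
  - generalize (tail_decreasing s0 f s y H Hs L); lra.
Qed.

Lemma tail_surjective (s0 : R) (f : R -> R) (s y : R) : cond_f1 s0 f -> s0 < s ->
  0 < y < tail f s -> exists s', s < s' /\ tail f s' = y.
Proof.
  intros H Hs Hy.
  assert (C : forall x, s0 < x -> continuity_pt (tail f) x).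
  { intros x Hx; apply continuity_pt_filterlim.
    apply (ex_derive_continuous (V := R_NormedModule) (tail f)).
    eexists; apply (is_derive_tail s0 f x H Hx). }
  destruct (IVT_Rbar_decr (tail f) s p_infty (tail f s) 0 y) as [x (Hx & _ & E)]; simpl; auto.
  - apply is_lim_continuity, C, Hs.
  - apply (filterlim_tail s0 f H).
  - intros x Hx _; apply C; lra.
  - exists x; auto.
Qed.

Lemma tail_tail_inv (s0 : R) (f : R -> R) (s y : R) : cond_f1 s0 f -> s0 < s ->
  0 < y < tail f s -> s < tail_inv s0 f y /\ tail f (tail_inv s0 f y) = y.
Proof.
  intros H Hs Hy; destruct (tail_surjective s0 f s y H Hs Hy) as [x [Hx <-]].
  rewrite tail_inv_tail by (auto; lra); auto.
Qed.

Lemma tail_lt_inv (s0 : R) (f : R -> R) (s t : R) : cond_f1 s0 f -> s0 < s -> s0 < t ->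
  tail f t < tail f s -> s < t.
Proof.
  intros H Hs Ht L; destruct (Rlt_le_dec s t) as [l|l]; [exact l|].
  destruct l as [l| ->]; [|lra].
  generalize (tail_decreasing s0 f t s H Ht l); lra.
Qed.

Lemma continuous_tail_inv (s0 : R) (f : R -> R) (s : R) : cond_f1 s0 f -> s0 < s ->
  continuous (tail_inv s0 f) (tail f s).
Proof.
  intros H Hs; apply filterlim_locally; intros eps.
  assert (He := cond_pos eps).
  set (d := Rmin eps ((s - s0) / 2)).
  assert (Hd : 0 < d) by (apply Rmin_glb_lt; lra).
  assert (Hd1 : d <= eps) by apply Rmin_l.
  assert (Hd2 : d <= (s - s0) / 2) by apply Rmin_r.
  assert (L1 := tail_decreasing s0 f (s - d) s H ltac:(lra) ltac:(lra)).
  assert (L2 := tail_decreasing s0 f s (s + d) H ltac:(lra) ltac:(lra)).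
  assert (P := tail_pos s0 f (s + d) H ltac:(lra)).
  generalize (filter_and _ _ (open_lt _ _ L1) (open_gt _ _ L2)).
  apply filter_imp; intros y [Hy1 Hy2].
  destruct (tail_tail_inv s0 f (s - d) y H ltac:(lra) ltac:(lra)) as [T1 T2].
  assert (T3 : tail_inv s0 f y < s + d).
  { apply (tail_lt_inv s0 f); auto; lra. }
  rewrite tail_inv_tail by assumption.
  change (Rabs (tail_inv s0 f y - s) < eps).
  apply Rabs_def1; lra.
Qed.

(** The mean value theorem for F gives s' - s = - f(c) h with c between s and s'; continuity of the
    inverse sends s' to s, and f(c) to f(s). *)
Lemma is_derive_tail_inv (s0 : R) (f : R -> R) (s : R) : cond_f1 s0 f -> s0 < s ->
  is_derive (tail_inv s0 f) (tail f s) (- f s).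
Proof.
  intros H Hs.
  assert (H' := H); destruct H' as [_ Hp].
  apply is_derive_Reals; intros eps Heps.
  destruct (proj1 (filterlim_locally _ _) (cond_f1_continuous s0 f s H Hs)
    (mkposreal eps Heps)) as [d1 Hd1].
  set (d := Rmin d1 (s - s0)).
  assert (Hd : 0 < d) by (apply Rmin_glb_lt; [apply cond_pos|lra]).
  assert (Hpos := tail_pos s0 f s H Hs).
  destruct (filter_and _ _
    (proj1 (filterlim_locally _ _) (continuous_tail_inv s0 f s H Hs) (mkposreal d Hd))
    (filter_and _ _ (open_gt _ _ Hpos) (open_lt _ _ 
       (tail_decreasing s0 f ((s0 + s) / 2) s H ltac:(lra) ltac:(lra)))))
    as [d2 Hd2].
  exists d2; intros h Hh Hhd.
  destruct (Hd2 (tail f s + h)) as [Hb [Hy1 Hy2]].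
  { change (Rabs (tail f s + h - tail f s) < d2).
    replace (tail f s + h - tail f s) with h by ring; exact Hhd. }
  rewrite tail_inv_tail in Hb |- * by assumption.
  change (Rabs (tail_inv s0 f (tail f s + h) - s) < d) in Hb.
  destruct (tail_tail_inv s0 f ((s0 + s) / 2) (tail f s + h) H ltac:(lra) ltac:(lra))
    as [T1 T2].
  set (s' := tail_inv s0 f (tail f s + h)) in *.
  destruct (MVT_gen (tail f) s s' (fun x => - / f x)) as [c [Hc Ec]].
  { intros x [Hx _]; apply (is_derive_tail s0 f x H).
    apply Rlt_trans with (2 := Hx), Rmin_glb_lt; lra. }
  { intros x [Hx _]; apply continuity_pt_filterlim.
    apply (ex_derive_continuous (V := R_NormedModule) (tail f)).
    eexists; apply (is_derive_tail s0 f x H).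
    apply Rlt_le_trans with (2 := Hx), Rmin_glb_lt; lra. }
  assert (Hc0 : s0 < c)
    by (apply Rlt_le_trans with (2 := proj1 Hc), Rmin_glb_lt; lra).
  assert (Hfc := proj1 (proj2 (Hp c Hc0))).
  assert (E : s' - s = - f c * h).
  { rewrite T2 in Ec. replace h with (- / f c * (s' - s)) by lra. field; lra. }
  rewrite E; replace (- f c * h / h - - f s) with (- (f c - f s)) by (field; exact Hh).
  rewrite Rabs_Ropp; apply (Hd1 c).
  change (Rabs (c - s) < d1).
  apply Rle_lt_trans with (Rabs (s' - s)).
  - revert Hc; unfold Rmin, Rmax; destruct (Rle_dec s s'); intros Hc.
    + rewrite !Rabs_pos_eq; lra.
    + rewrite !Rabs_left1; lra.
  - apply Rlt_le_trans with (1 := Hb), Rmin_l.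
Qed.

Lemma is_lim_eventually_near (g : R -> R) (l e : R) : is_lim g p_infty l -> 0 < e ->
  Rbar_locally p_infty (fun s => Rabs (g s - l) < e).
Proof.
  intros H He; apply is_lim_spec in H; exact (H (mkposreal e He)).
Qed.

(** 1/B_2 tends to 1/B <= 1 and contains the factor f'F (log F)^2, which is large, so the bracket f
    f''F/f' - 1 is small; hence f f''F^2 is close to f'F, which is close to 1. *)
Lemma cond_f2_bounds (s0 : R) (f : R -> R) (B : R) : cond_f1 s0 f -> cond_f2 f B ->
  exists s1, s0 < s1 /\ forall s, s1 < s ->
    / 2 < Derive f s * tail f s < 3 / 2 /\
    Rabs (Derive_n f 2 s * f s * tail f s ^ 2) <= 2.
Proof.
  intros H (L1 & L2 & HB).
  assert (L2' : is_lim (recip_B2 f) p_infty (/ B)).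
  { apply is_lim_ext with (fun s => / B2 f s).
    - intros s; unfold B2; apply Rinv_inv.
    - apply (is_lim_inv (B2 f) p_infty B L2).
      intros E; injection E; lra. }
  assert (HB' : / B <= 1) by (rewrite <- Rinv_1; apply Rinv_le_contravar; lra).
  assert (HB'' : 0 < / B) by (apply Rinv_0_lt_compat; lra).
  (* F < e^(-4) gives (log F)^2 > 16, so f'F (log F)^2 > 8. Since 1/B_2 has absolute value below 2,
     the bracket is below 1/4, and (3/2)(5/4) <= 2. *)
  assert (LF : Rbar_locally p_infty (fun s => tail f s < exp (- (4)))).
  { exact (filterlim_tail s0 f H (fun y => y < exp (- (4))) (open_lt _ _ (exp_pos _))). }
  assert (N1 := is_lim_eventually_near _ _ (/ 2) L1 ltac:(lra)).
  assert (N2 := is_lim_eventually_near _ _ 1 L2' ltac:(lra)).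
  destruct (filter_and _ _ N1 (filter_and _ _ N2 LF)) as [K HK].
  exists (Rmax K s0 + 1); split; [generalize (Rmax_r K s0); lra|].
  intros s Hs.
  destruct (HK s ltac:(generalize (Rmax_l K s0); lra)) as (H1 & H2 & H3).
  assert (Hs0 : s0 < s) by (generalize (Rmax_r K s0); lra).
  apply Rabs_def2 in H1, H2.
  assert (HF := tail_pos s0 f s H Hs0).
  destruct H as [_ H]; destruct (H s Hs0) as (_ & Hf & Hf' & _).
  split; [lra|].
  assert (HL : 4 < - ln (tail f s)).
  { apply ln_increasing in H3; [|exact HF]; rewrite ln_exp in H3; lra. }
  unfold recip_B2 in H2.
  set (a := Derive f s * tail f s) in *.
  set (L := - ln (tail f s)) in *.
  set (e := f s * Derive_n f 2 s * tail f s / Derive f s - 1) in *.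
  replace (Derive_n f 2 s * f s * tail f s ^ 2) with (a * (1 + e))
    by (unfold a, e; field; lra).
  assert (H16 : 16 < L ^ 2) by (simpl; nra).
  assert (He : - (1 / 4) <= e <= 1 / 4).
  { assert (Ha : 8 < a * L ^ 2) by nra.
    split; apply Rnot_lt_le; intros HH; nra. }
  rewrite Rabs_pos_eq; nra.
Qed.

(** This is -F/F', the length over which F changes by a fixed factor: the natural unit for
    perturbations of [s]. *)
Definition mass (f : R -> R) (s : R) : R := f s * tail f s.

Lemma mass_pos (s0 : R) (f : R -> R) (s : R) : cond_f1 s0 f -> s0 < s -> 0 < mass f s.
Proof.
  intros H Hs; apply Rmult_lt_0_compat; [|apply (tail_pos s0); assumption].
  destruct H as [_ H]; apply (H s Hs).
Qed.

Lemma is_derive_mass (s0 : R) (f : R -> R) (s : R) : cond_f1 s0 f -> s0 < s ->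
  is_derive (mass f) s (Derive f s * tail f s - 1).
Proof.
  intros H Hs; unfold mass.
  assert (Hp : 0 < f s) by (destruct H as [_ H]; apply (H s Hs)).
  evar_last.
  - apply (is_derive_mult f (tail f)).
    + apply (cond_f1_derive s0 f s H Hs).
    + apply (is_derive_tail s0 f s H Hs).
    + intros; apply Rmult_comm.
  - unfold plus, mult; simpl; field; lra.
Qed.

Lemma MVT_derive (g g' : R -> R) (x y : R) :
  (forall z, Rmin x y <= z <= Rmax x y -> is_derive g z (g' z)) ->
  exists z, Rmin x y <= z <= Rmax x y /\ g y - g x = g' z * (y - x).
Proof.
  intros H; apply MVT_gen.
  - intros z Hz; apply H; lra.
  - intros z Hz; apply continuity_pt_filterlim.
    apply (ex_derive_continuous (V := R_NormedModule) g).
    eexists; apply (H z Hz).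
Qed.

(** Within a quarter of the mass, neither the mass nor F falls below 3/4 of its value at [u]: the
    mass has slope f'F - 1 in (-1/2, 1/2), and F, decreasing, loses at most (s - u)/f(u) to the
    right since f increases. So the bound 2 on |f''| f F^2 at [s] becomes 2 (4/3)^2 <= 4. *)
Lemma second_derivative_bound (s0 s1 : R) (f : R -> R) (u s : R) :
  cond_f1 s0 f -> s0 < s1 ->
  (forall s, s1 < s ->
    / 2 < Derive f s * tail f s < 3 / 2 /\
    Rabs (Derive_n f 2 s * f s * tail f s ^ 2) <= 2) ->
  s1 < u - mass f u / 4 -> Rabs (s - u) <= mass f u / 4 ->
  s1 < s /\ tail f u * Rabs (Derive_n f 2 s) * mass f u <= 4.
Proof.
  intros H H01 Hb Hu Hs.
  assert (Hs' := proj1 (Rabs_le_between _ _) Hs).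
  assert (Hm0 : 0 <= mass f u / 4) by (apply Rle_trans with (2 := Hs), Rabs_pos).
  assert (Hs1 : s1 < s) by lra.
  split; [exact Hs1|].
  assert (Hpos := H); destruct Hpos as [_ Hpos].
  assert (fu := proj1 (proj2 (Hpos u ltac:(lra)))).
  assert (fs := proj1 (proj2 (Hpos s ltac:(lra)))).
  assert (Fu := tail_pos s0 f u H ltac:(lra)).
  assert (Fs := tail_pos s0 f s H ltac:(lra)).
  assert (Hz : forall z, Rmin u s <= z <= Rmax u s -> s1 < z).
  { intros z [Hz _]; apply Rlt_le_trans with (2 := Hz), Rmin_glb_lt; lra. }
  assert (M1 : 3 / 4 * mass f u <= mass f s).
  { destruct (MVT_derive (mass f) (fun s => Derive f s * tail f s - 1) u s) as [z [Iz Ez]].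
    { intros z Iz; apply (is_derive_mass s0); [exact H|]; specialize (Hz z Iz); lra. }
    destruct (Hb z (Hz z Iz)) as [[b1 b2] _].
    set (d := Derive f z * tail f z) in *. nra. }
  assert (M2 : 3 / 4 * tail f u <= tail f s).
  { destruct (Rle_lt_dec s u) as [l|l].
    - destruct l as [l| ->]; [|lra].
      generalize (tail_decreasing s0 f s u H ltac:(lra) l); lra.
    - destruct (MVT_derive (tail f) (fun s => - / f s) u s) as [z [Iz Ez]].
      { intros z Iz; apply (is_derive_tail s0); [exact H|]; specialize (Hz z Iz); lra. }
      rewrite Rmin_left, Rmax_right in Iz by lra.
      assert (Mf : f u <= f z).
      { destruct (MVT_derive f (Derive f) u z) as [y [Iy Ey]].
        - intros y; rewrite Rmin_left by lra; intros Iy.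
          apply (cond_f1_derive s0 f y H); lra.
        - rewrite Rmin_left in Iy by lra.
          generalize (proj1 (proj2 (proj2 (Hpos y ltac:(lra))))); intros P; nra. }
      assert (Mi : / f z <= / f u) by (apply Rinv_le_contravar; assumption).
      assert (Mi0 : / f u * (s - u) <= / f u * (mass f u / 4)).
      { apply Rmult_le_compat_l; [apply Rlt_le, Rinv_0_lt_compat, fu|lra]. }
      replace (/ f u * (mass f u / 4)) with (tail f u / 4) in Mi0
        by (unfold mass; field; lra).
      nra. }
  destruct (Hb s Hs1) as [_ B2].
  rewrite !Rabs_mult, (Rabs_pos_eq (f s)), (Rabs_pos_eq (tail f s ^ 2)) in B2
    by (try apply pow2_ge_0; lra).
  set (d := Rabs (Derive_n f 2 s)) in *.
  assert (Hd : 0 <= d) by apply Rabs_pos.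
  assert (Mp : 0 < mass f u) by (unfold mass; apply Rmult_lt_0_compat; assumption).
  assert (Q : 3 / 4 * mass f u * (3 / 4 * tail f u) <= mass f s * tail f s)
    by (apply Rmult_le_compat; lra).
  assert (Q' : d * (3 / 4 * mass f u * (3 / 4 * tail f u)) <= d * (mass f s * tail f s))
    by (apply Rmult_le_compat_l; assumption).
  replace (d * (mass f s * tail f s)) with (d * f s * tail f s ^ 2) in Q'
    by (unfold mass; ring).
  lra.
Qed.

(** Two mean value theorems write the left side as F(u) f''(y) (z - u) (w1 - w2) with |z - u| <= k
    [mass f u]; the preceding lemma bounds F |f''| times the mass by 4. *)
Lemma nonlinear_remainder (s0 s1 : R) (f : R -> R) (u k w1 w2 : R) :
  cond_f1 s0 f -> s0 < s1 ->
  (forall s, s1 < s ->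
    / 2 < Derive f s * tail f s < 3 / 2 /\
    Rabs (Derive_n f 2 s * f s * tail f s ^ 2) <= 2) ->
  s0 < u -> s1 < u - mass f u / 4 -> k <= / 4 ->
  Rabs w1 <= k * mass f u -> Rabs w2 <= k * mass f u ->
  Rabs (tail f u * (f (u + w1) - f (u + w2)) - Derive f u * tail f u * (w1 - w2))
    <= 4 * k * Rabs (w1 - w2).
Proof.
  intros H H01 Hb Hu0 Hu Hk Hw1 Hw2.
  assert (Mp := mass_pos s0 f u H Hu0).
  assert (Hk4 : forall w, Rabs w <= k * mass f u -> Rabs w <= mass f u / 4) by (intros; nra).
  assert (HD : forall z, Rabs (z - u) <= k * mass f u ->
    s1 < z /\ tail f u * Rabs (Derive_n f 2 z) * mass f u <= 4).
  { intros z Hz; apply (second_derivative_bound s0 s1 f u z); auto. }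
  assert (IN : forall x y z, Rabs (x - u) <= k * mass f u -> Rabs (y - u) <= k * mass f u ->
     Rmin x y <= z <= Rmax x y -> Rabs (z - u) <= k * mass f u).
  { intros x y z Hx Hy Hz; apply Rabs_le_between; apply Rabs_le_between in Hx, Hy.
    revert Hz; unfold Rmin, Rmax; destruct Rle_dec; lra. }
  assert (W1 : Rabs (u + w1 - u) <= k * mass f u)
    by (replace (u + w1 - u) with w1 by ring; exact Hw1).
  assert (W2 : Rabs (u + w2 - u) <= k * mass f u)
    by (replace (u + w2 - u) with w2 by ring; exact Hw2).
  assert (W0 : Rabs (u - u) <= k * mass f u).
  { rewrite Rminus_diag, Rabs_R0; apply Rle_trans with (2 := Hw1), Rabs_pos. }
  destruct (MVT_derive f (Derive f) (u + w2) (u + w1)) as [z [Iz Ez]].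
  { intros z Iz; apply (cond_f1_derive s0 f z H).
    generalize (HD z (IN _ _ _ W2 W1 Iz)); lra. }
  assert (Hz := IN _ _ _ W2 W1 Iz).
  destruct (MVT_derive (Derive f) (Derive_n f 2) u z) as [y [Iy Ey]].
  { intros y Iy; apply (cond_f1_derive s0 f y H).
    generalize (HD y (IN _ _ _ W0 Hz Iy)); lra. }
  destruct (HD y (IN _ _ _ W0 Hz Iy)) as [_ By].
  assert (Fu : 0 < tail f u) by (apply (tail_pos s0 f u H); lra).
  replace (tail f u * (f (u + w1) - f (u + w2)) - Derive f u * tail f u * (w1 - w2))
    with (tail f u * (Derive f z - Derive f u) * (w1 - w2))
    by (rewrite Ez; ring).
  rewrite Ey, !Rabs_mult, (Rabs_pos_eq (tail f u)) by lra.
  apply Rmult_le_compat_r; [apply Rabs_pos|].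
  set (d := Rabs (Derive_n f 2 y)) in *.
  assert (Hd : 0 <= tail f u * d) by (apply Rmult_le_pos; [lra|apply Rabs_pos]).
  apply Rle_trans with (tail f u * d * (k * mass f u)).
  - rewrite <- Rmult_assoc; apply Rmult_le_compat_l; assumption.
  - destruct (Rle_lt_dec 0 k) as [l|l].
    + replace (tail f u * d * (k * mass f u)) with (tail f u * d * mass f u * k) by ring.
      apply Rmult_le_compat_r; assumption.
    + exfalso; generalize (Rabs_pos w1); nra.
Qed.

(** * Liouville substitution *)

Definition phase (B t : R) : R := 2 * sqrt (t / B).
Definition time (B x : R) : R := B / 4 * x ^ 2.

Lemma phase_pos (B t : R) : 0 < B -> 0 < t -> 0 < phase B t.
Proof.
  intros HB Ht; unfold phase.
  generalize (sqrt_lt_R0 (t / B) (Rdiv_lt_0_compat _ _ Ht HB)); lra.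
Qed.

Lemma time_phase (B t : R) : 0 < B -> 0 < t -> time B (phase B t) = t.
Proof.
  intros HB Ht; unfold time, phase.
  replace (B / 4 * (2 * sqrt (t / B)) ^ 2) with (B * (sqrt (t / B) * sqrt (t / B))) by field.
  rewrite sqrt_sqrt by (apply Rlt_le, Rdiv_lt_0_compat; assumption).
  field; lra.
Qed.

Lemma is_derive_phase (B t : R) : 0 < B -> 0 < t ->
  is_derive (phase B) t (2 / (B * phase B t)).
Proof.
  intros HB Ht; unfold phase.
  assert (H := Rdiv_lt_0_compat _ _ Ht HB); assert (Hs := sqrt_lt_R0 _ H).
  auto_derive; [exact H|].
  unfold Rdiv in *; field; lra.
Qed.

Lemma is_derive_time (B x : R) : is_derive (time B) x (B / 2 * x).
Proof. unfold time; auto_derive; [exact I|field]. Qed.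

Lemma time_gt (B T x : R) : 0 < B -> 0 < T -> phase B T < x -> T < time B x.
Proof.
  intros HB HT Hx; rewrite <- (time_phase B T HB HT) at 1.
  assert (Hp := phase_pos B T HB HT); unfold time.
  apply Rmult_lt_compat_l; [lra|]. simpl; nra.
Qed.

Lemma phase_lt (B s t : R) : 0 < B -> 0 < s < t -> phase B s < phase B t.
Proof.
  intros HB Hst; unfold phase; apply Rmult_lt_compat_l; [lra|].
  assert (Hi := Rinv_0_lt_compat B HB).
  apply sqrt_lt_1; unfold Rdiv; nra.
Qed.

(* Liouville's substitution: in the variable sigma = phase B t the
   operator d^2/dt^2 + 1/(B t) + 3/(16 t^2) on sqrt(sigma) q becomes a multiple of q'' + q. *)
Lemma is_derive_liouville (B T : R) (q q' q2 : R -> R) :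
  0 < B -> 0 < T ->
  (forall x, phase B T < x -> is_derive q x (q' x)) ->
  (forall x, phase B T < x -> is_derive q' x (q2 x)) ->
  let w := fun t => sqrt (phase B t) * q (phase B t) in
  let w' := fun t => let x := phase B t in
    (q x / (2 * sqrt x) + sqrt x * q' x) * (2 / (B * x)) in
  forall t, T < t -> is_derive w t (w' t) /\
    is_derive w' t (let x := phase B t in
      / (B * t) * (sqrt x * q2 x - 3 / 4 * (sqrt x * q x) / x ^ 2)).
Proof.
  intros HB HT Hq Hq' w w' t Ht.
  assert (Hx : phase B T < phase B t) by (apply phase_lt; [exact HB|lra]).
  assert (HT0 := phase_pos B T HB HT).
  assert (D1 := Hq _ Hx). assert (D2 := Hq' _ Hx).
  assert (Ds := is_derive_phase B t HB ltac:(lra)).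
  assert (Et := time_phase B t HB ltac:(lra)).
  set (x := phase B t) in *.
  assert (Hs : 0 < sqrt x) by (apply sqrt_lt_R0; lra).
  split.
  - evar_last.
    + apply (is_derive_comp (V := R_NormedModule) (fun x => sqrt x * q x) (phase B)).
      * apply (is_derive_mult sqrt q).
        -- apply (is_derive_sqrt (fun x => x) x 1); [|fold x; lra].
           apply (is_derive_id (K := R_AbsRing)).
        -- exact D1.
        -- intros; apply Rmult_comm.
      * exact Ds.
    + unfold w'; fold x; unfold scal, plus, mult; simpl; unfold plus, mult; simpl.
      field; lra.
  - evar_last.
    + apply (is_derive_comp (V := R_NormedModule)
        (fun x => (q x / (2 * sqrt x) + sqrt x * q' x) * (2 / (B * x))) (phase B));
        [|exact Ds].
      fold x.
      assert (V1 : Derive (fun y => q y) x = q' x) by (apply is_derive_unique, D1).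
      assert (V2 : Derive (fun y => q' y) x = q2 x) by (apply is_derive_unique, D2).
      auto_derive.
      * repeat split; try lra; try (eexists; eassumption).
        apply Rgt_not_eq; nra.
      * rewrite V1, V2; reflexivity.
    + rewrite <- Et; unfold time; fold x; unfold scal; simpl; unfold mult; simpl.
      (* Expressed in the square root of [x], the identity becomes rational and [field] can decide
         it. *)
      assert (E : x = sqrt x * sqrt x) by (symmetry; apply sqrt_sqrt; lra).
      set (y := sqrt x) in *. rewrite !E. field; repeat split; lra.
Qed.

(** The defect m (t/(t+1))^2 d times B t, which clears the factor 1/(B t) of Liouville's
    substitution. *)
Definition forcing (B : R) (d m : R -> R) (t : R) : R :=
  B * (t ^ 3 / (t + 1) ^ 2) * d t * m t.

Definition forcing' (B : R) (d d' m a : R -> R) (t : R) : R :=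
  B * m t * (t ^ 2 * (t + 3) / (t + 1) ^ 3 * d t
    + t ^ 3 / (t + 1) ^ 2 * (d' t - d t * (t / (t + 1) * a t))).

Lemma is_derive_forcing (B : R) (d d' m a : R -> R) (t : R) : 0 < t ->
  is_derive d t (d' t) -> is_derive m t (- (t / (t + 1) * m t * a t)) ->
  is_derive (forcing B d m) t (forcing' B d d' m a t).
Proof.
  intros Ht Dd Dm; unfold forcing, forcing'.
  assert (V1 : Derive (fun y => d y) t = d' t) by (apply is_derive_unique, Dd).
  assert (V2 : Derive (fun y => m y) t = - (t / (t + 1) * m t * a t))
    by (apply is_derive_unique, Dm).
  auto_derive.
  - repeat split; try (eexists; eassumption). apply Rgt_not_eq; nra.
  - rewrite V1, V2; field; lra.
Qed.

(** Slow variation: differentiating gains a full factor 1/t, because d', a and the derivative of the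
    rational factor all do. The constant is 20 = 3*2 + 4 + 2*5. *)
Lemma forcing_bound (B r : R) (d d' m a : R -> R) (t : R) :
  1 <= B -> 1 <= t -> 0 <= m t -> 0 <= r ->
  Rabs (d t) <= 2 * r / t -> Rabs (d' t) <= 4 * r / t ^ 2 -> 0 <= a t <= 5 / t ->
  Rabs (forcing B d m t) <= 2 * B * (m t * r) /\
  Rabs (forcing' B d d' m a t) <= 20 * B * (m t * r) / t.
Proof.
  intros HB Ht Hm Hr Hd Hd' Ha; unfold forcing, forcing'.
  assert (Hi : 0 < / t) by (apply Rinv_0_lt_compat; lra).
  assert (X1 : 0 <= t ^ 3 / (t + 1) ^ 2 <= t).
  { assert (Hp : 0 < (t + 1) ^ 2) by (apply pow_lt; lra).
    assert (Ht3 : 0 <= t ^ 3) by (apply pow_le; lra).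
    split; [apply Rmult_le_pos; [exact Ht3|apply Rlt_le, Rinv_0_lt_compat, Hp]|].
    apply Rle_div_l; [exact Hp|]. simpl; nra. }
  assert (X2 : 0 <= t ^ 2 * (t + 3) / (t + 1) ^ 3 <= 3).
  { assert (Hp : 0 < (t + 1) ^ 3) by (apply pow_lt; lra).
    assert (Ht3 : 0 <= t ^ 2 * (t + 3)) by (apply Rmult_le_pos; [apply pow_le|]; lra).
    split; [apply Rmult_le_pos; [exact Ht3|apply Rlt_le, Rinv_0_lt_compat, Hp]|].
    apply Rle_div_l; [exact Hp|]. simpl; nra. }
  assert (X3 : 0 <= t / (t + 1) <= 1).
  { split; [apply Rdiv_le_0_compat; lra|]. apply Rle_div_l; lra. }
  set (x1 := t ^ 3 / (t + 1) ^ 2) in *. set (x2 := t ^ 2 * (t + 3) / (t + 1) ^ 3) in *.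
  set (x3 := t / (t + 1)) in *.
  assert (Hx1d : Rabs (x1 * d t) <= 2 * r).
  { rewrite Rabs_mult, (Rabs_pos_eq x1) by lra.
    apply Rle_trans with (t * (2 * r / t)).
    - apply Rmult_le_compat; try lra; apply Rabs_pos.
    - right; field; lra. }
  split.
  - replace (B * x1 * d t * m t) with (B * m t * (x1 * d t)) by ring.
    rewrite Rabs_mult, (Rabs_pos_eq (B * m t)) by nra.
    replace (2 * B * (m t * r)) with (B * m t * (2 * r)) by ring.
    apply Rmult_le_compat_l; [nra|exact Hx1d].
  - rewrite Rabs_mult, (Rabs_pos_eq (B * m t)) by nra.
    replace (20 * B * (m t * r) / t) with (B * m t * (3 * (2 * r / t) + (t * (4 * r / t ^ 2)
      + 2 * r * (5 / t)))) by (field; lra).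
    apply Rmult_le_compat_l; [nra|].
    apply Rle_trans with (1 := Rabs_triang _ _), Rplus_le_compat.
    + rewrite Rabs_mult, (Rabs_pos_eq x2) by lra.
      apply Rmult_le_compat; try lra; apply Rabs_pos.
    + replace (x1 * (d' t - d t * (x3 * a t)))
        with (x1 * d' t + - (x1 * d t * (x3 * a t))) by ring.
      apply Rle_trans with (1 := Rabs_triang _ _); rewrite Rabs_Ropp.
      apply Rplus_le_compat.
      * rewrite Rabs_mult, (Rabs_pos_eq x1) by lra.
        apply Rmult_le_compat; try lra; apply Rabs_pos.
      * rewrite Rabs_mult, (Rabs_pos_eq (x3 * a t)) by nra.
        apply Rmult_le_compat; try nra; apply Rabs_pos.
Qed.

Lemma continuous_mult_R (f g : R -> R) (x : R) :
  continuous f x -> continuous g x -> continuous (fun x => f x * g x) x.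
Proof. apply (continuous_mult (K := R_AbsRing)). Qed.

Lemma continuous_time (B : R) (g : R -> R) (x : R) :
  continuous g (time B x) -> continuous (fun x => g (time B x)) x.
Proof.
  intros H; apply (continuous_comp (time B) g); [|exact H].
  apply (ex_derive_continuous (V := R_NormedModule)); eexists; apply is_derive_time.
Qed.

Lemma continuous_of_derive (f : R -> R) (x l : R) : is_derive f x l -> continuous f x.
Proof.
  intros H; apply (ex_derive_continuous (V := R_NormedModule)); exists l; exact H.
Qed.

Section Perturbation.

Variables (B T : R) (f u m a d d' rho : R -> R).
Hypothesis HB : 1 <= B.
Hypothesis HT : 1 <= T.
Hypothesis HT' : 400 <= phase B T.
Hypothesis Hm : forall t, T < t -> 0 < m t.
Hypothesis Du : forall t, T < t -> is_derive u t (t / (t + 1) * m t).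
Hypothesis Dm : forall t, T < t -> is_derive m t (- (t / (t + 1) * m t * a t)).
Hypothesis Dd : forall t, T < t -> is_derive d t (d' t).
Hypothesis Cd' : forall t, T < t -> continuous d' t.
Hypothesis Ca : forall t, T < t -> continuous a t.
Hypothesis Bd : forall t, T < t -> Rabs (d t) <= 2 * rho t / t.
Hypothesis Bd' : forall t, T < t -> Rabs (d' t) <= 4 * rho t / t ^ 2.
Hypothesis Ba : forall t, T < t -> 0 <= a t <= 5 / t.
Hypothesis Hrho : forall t, T < t -> 0 <= rho t.
Hypothesis Mrho : forall s t, T < s -> s <= t -> rho t <= rho s.
Hypothesis Srho : forall t, T < t -> 410 * B * rho t * sqrt t <= / 128.
Hypothesis HL : forall t k w1 w2, T < t -> k <= / 4 ->
  Rabs w1 <= k * m t -> Rabs w2 <= k * m t ->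
  Rabs (model_G B t * (f (u t + w1) - f (u t + w2)) - (1 - a t) * (w1 - w2))
    <= 4 * k * Rabs (w1 - w2).
Hypothesis Hf : forall t w, T < t -> Rabs w <= m t / 4 -> continuous f (u t + w).

Let S := phase B T.
Let M x := m (time B x) * rho (time B x).
Let h x := forcing B d m (time B x) / sqrt x.
Let h' x := forcing' B d d' m a (time B x) * (B / 2 * x) / sqrt x
  - forcing B d m (time B x) / (2 * (x * sqrt x)).
(** Everything that separates the equation from q'' + q = h: the Liouville potential 3/(4 x^2), the
    linear coefficient (1 - a) t/(t+1) replaced by 1, and the nonlinear remainder of f. *)
Let N x q := let t := time B x in
  3 / 4 * q / x ^ 2 + q
  - t / (t + 1) * (model_G B t * (f (u t + sqrt x * q) - f (u t))) / sqrt x.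

Lemma perturbation_pos (x : R) : S < x ->
  T < time B x /\ 400 < x /\ 0 < sqrt x /\ 0 < time B x /\ time B x = B / 4 * (x * x).
Proof.
  intros Hx; assert (H := time_gt B T x ltac:(lra) ltac:(lra) Hx).
  assert (H4 : 400 < x) by (unfold S in Hx; lra).
  assert (Hs := sqrt_lt_R0 x ltac:(lra)).
  repeat split; auto; try lra. unfold time; ring.
Qed.

Lemma m_nonincreasing (s t : R) : T < s -> s <= t -> m t <= m s.
Proof.
  intros Hs Hst.
  destruct (MVT_gen m s t (fun t => - (t / (t + 1) * m t * a t))) as [z [Iz Ez]].
  - intros z [Hz _]; rewrite Rmin_left in Hz by lra; apply Dm; lra.
  - intros z [Hz _]; rewrite Rmin_left in Hz by lra.
    apply continuity_pt_filterlim, (continuous_of_derive m z _ (Dm z ltac:(lra))).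
  - rewrite Rmin_left in Iz by lra.
    assert (H1 := Hm z ltac:(lra)). assert (H2 := Ba z ltac:(lra)).
    assert (H3 : 0 <= z / (z + 1)) by (apply Rdiv_le_0_compat; lra).
    assert (H4 : 0 <= z / (z + 1) * m z * a z)
      by (apply Rmult_le_pos; [apply Rmult_le_pos|]; lra).
    nra.
Qed.

Lemma weight_perturbation : weight S M.
Proof.
  assert (HS : 0 <= S) by (unfold S; lra).
  split; [exact HS|split].
  - intros x Hx; destruct (perturbation_pos x Hx) as (Ht & _).
    apply Rmult_le_pos; [apply Rlt_le, Hm, Ht|apply Hrho, Ht].
  - intros x y Hx Hxy; destruct (perturbation_pos x Hx) as (Ht & Hx4 & _).
    assert (Hxy' : time B x <= time B y)
      by (unfold time; apply Rmult_le_compat_l; [lra|]; simpl; nra).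
    unfold M; apply Rmult_le_compat.
    + apply Rlt_le, Hm; lra.
    + apply Hrho; lra.
    + apply m_nonincreasing; assumption.
    + apply Mrho; assumption.
Qed.

(** The factor sqrt x in w = sqrt x q cancels the decay of q, so |w| <= k m with k = 410 B rho. *)
Lemma perturbation_small (x q : R) : S < x -> Rabs q <= 10 * (41 * B) * M x / sqrt x ->
  Rabs (sqrt x * q) <= 410 * B * rho (time B x) * m (time B x).
Proof.
  intros Hx Hq; destruct (perturbation_pos x Hx) as (Ht & Hx4 & Hs & _).
  rewrite Rabs_mult, (Rabs_pos_eq (sqrt x)) by lra.
  apply Rmult_le_compat_l with (r := sqrt x) in Hq; [|lra].
  apply Rle_trans with (1 := Hq); right; unfold M; field; lra.
Qed.

(** The smallness of t^(1/2) rho in the phase variable: B >= 1 gives x <= 2 sqrt t, which turns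
    1/128 into 1/64. *)
Lemma rho_time_small (x : R) : S < x -> 410 * B * rho (time B x) * x <= / 64.
Proof.
  intros Hx; destruct (perturbation_pos x Hx) as (Ht & Hx4 & Hs & Ht0 & E).
  assert (H := Srho (time B x) Ht).
  assert (Hx2 : x <= 2 * sqrt (time B x)).
  { assert (Hq : sqrt (Rsqr (x / 2)) <= sqrt (time B x))
      by (apply sqrt_le_1_alt; rewrite E; unfold Rsqr; nra).
    rewrite sqrt_Rsqr in Hq; lra. }
  assert (Hr := Hrho _ Ht).
  assert (Hr' : 0 <= 410 * B * rho (time B x)) by (apply Rmult_le_pos; lra).
  nra.
Qed.

Lemma rho_time_small' (x : R) : S < x -> 410 * B * rho (time B x) <= / 4.
Proof.
  intros Hx; destruct (perturbation_pos x Hx) as (Ht & Hx4 & Hs & Ht0 & E).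
  assert (H := rho_time_small x Hx).
  assert (Hr' : 0 <= 410 * B * rho (time B x))
    by (apply Rmult_le_pos; [lra|apply Hrho, Ht]).
  nra.
Qed.

(** Half of 1/(8 x) is spent on the linear coefficients, which are O(1/x^2), and half on the
    nonlinear remainder. *)
Lemma N_lipschitz (x p q : R) : S < x ->
  Rabs p <= 10 * (41 * B) * M x / sqrt x -> Rabs q <= 10 * (41 * B) * M x / sqrt x ->
  Rabs (N x p - N x q) <= Rabs (p - q) / (8 * x).
Proof.
  intros Hx Hp Hq; destruct (perturbation_pos x Hx) as (Ht & Hx4 & Hs & Ht0 & E).
  apply perturbation_small in Hp, Hq; auto.
  assert (L := HL _ _ _ _ Ht (rho_time_small' x Hx) Hp Hq).
  assert (K := rho_time_small x Hx).
  assert (HA := Ba _ Ht).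
  unfold N.
  set (t := time B x) in *.
  set (k := 410 * B * rho t) in *.
  set (e := model_G B t * (f (u t + sqrt x * p) - f (u t + sqrt x * q)) -
       (1 - a t) * (sqrt x * p - sqrt x * q)) in *.
  set (c := t / (t + 1)).
  assert (Hc : 0 <= c <= 1).
  { unfold c; split; [apply Rdiv_le_0_compat; lra|]. apply Rle_div_l; lra. }
  match goal with |- Rabs ?g <= _ => replace g with
    ((p - q) * (3 / 4 / x ^ 2 + (/ (t + 1) + c * a t)) - c * (e / sqrt x)) end.
  2: { unfold e, c; field; lra. }
  assert (Hi : 0 < / x) by (apply Rinv_0_lt_compat; lra).
  assert (Hix : / x <= / 400) by (apply Rinv_le_contravar; lra).
  assert (Hit : / t <= 4 * (/ x * / x)).
  { replace (4 * (/ x * / x)) with (/ (/ 4 * (x * x))) by (field; lra).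
    apply Rinv_le_contravar; nra. }
  assert (Hit1 : 0 < / (t + 1) <= / t).
  { split; [apply Rinv_0_lt_compat; lra|apply Rinv_le_contravar; lra]. }
  assert (Hca : 0 <= c * a t <= 5 * / t) by (unfold Rdiv in HA; nra).
  (* With 1/t <= 4/x^2 the sum is at most (3/4 + 4 + 20)/x^2, and 16 * 24.75 = 396: this is why the
     phase is required to exceed 400. *)
  assert (X : 0 <= 3 / 4 / x ^ 2 + (/ (t + 1) + c * a t) <= / 16 * / x).
  { replace (3 / 4 / x ^ 2) with (3 / 4 * (/ x * / x)) by (field; lra). nra. }
  assert (He : Rabs (c * (e / sqrt x)) <= Rabs (p - q) * (/ 16 * / x)).
  { rewrite Rabs_mult, (Rabs_pos_eq c) by lra.
    unfold Rdiv; rewrite Rabs_mult, (Rabs_pos_eq (/ sqrt x))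
      by (apply Rlt_le, Rinv_0_lt_compat, Hs).
    rewrite <- Rmult_minus_distr_l, Rabs_mult, (Rabs_pos_eq (sqrt x)) in L by lra.
    assert (Y : Rabs e * / sqrt x <= 4 * k * Rabs (p - q)).
    { apply Rle_div_l; [exact Hs|].
      apply Rle_trans with (1 := L); right; ring. }
    assert (Y0 : 0 <= Rabs e * / sqrt x)
      by (apply Rmult_le_pos; [apply Rabs_pos|apply Rlt_le, Rinv_0_lt_compat, Hs]).
    assert (Hk : 4 * k <= / 16 * / x).
    { apply Rmult_le_reg_r with x; [lra|].
      replace (/ 16 * / x * x) with (/ 16) by (field; lra). lra. }
    assert (Hpq := Rabs_pos (p - q)). nra. }
  unfold Rminus at 1; apply Rle_trans with (1 := Rabs_triang _ _); rewrite Rabs_Ropp.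
  replace (Rabs (p - q) / (8 * x))
    with (Rabs (p - q) * (/ 16 * / x) + Rabs (p - q) * (/ 16 * / x)) by (field; lra).
  apply Rplus_le_compat; [|exact He].
  rewrite Rabs_mult; apply Rmult_le_compat_l; [apply Rabs_pos|].
  rewrite Rabs_pos_eq; lra.
Qed.

Lemma N_continuous (q : R -> R) :
  (forall x, S < x -> continuous q x) ->
  (forall x, S < x -> Rabs (q x) <= 10 * (41 * B) * M x / sqrt x) ->
  forall x, S < x -> continuous (fun x => N x (q x)) x.
Proof.
  intros Cq Bq x Hx; destruct (perturbation_pos x Hx) as (Ht & Hx4 & Hs & Ht0 & E).
  assert (Cs : continuous sqrt x).
  { apply (continuous_of_derive sqrt x (/ (2 * sqrt x))).
    auto_derive; [lra|field; lra]. }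
  assert (Cu : continuous (fun x => u (time B x)) x)
    by (apply continuous_time, (continuous_of_derive u _ _ (Du _ Ht))).
  assert (W : Rabs (sqrt x * q x) <= m (time B x) / 4).
  { apply Rle_trans with (1 := perturbation_small x (q x) Hx (Bq x Hx)).
    generalize (rho_time_small' x Hx) (Hm _ Ht); nra. }
  assert (W0 : Rabs 0 <= m (time B x) / 4)
    by (rewrite Rabs_R0; generalize (Hm _ Ht); lra).
  assert (F0 := Hf _ _ Ht W0); rewrite Rplus_0_r in F0.
  unfold N; cbv zeta.
  apply (continuous_minus (V := R_NormedModule)).
  - apply (continuous_plus (V := R_NormedModule)); [|apply Cq, Hx].
    apply continuous_mult_R; [apply continuous_mult_R; [apply continuous_const|apply Cq, Hx]|].
    apply (ex_derive_continuous (V := R_NormedModule)); auto_derive.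
    apply Rgt_not_eq; nra.
  - apply continuous_mult_R.
    + apply continuous_mult_R; [|apply continuous_mult_R].
      * apply (continuous_time B (fun t => t / (t + 1))).
        apply (ex_derive_continuous (V := R_NormedModule)); auto_derive; lra.
      * apply continuous_time, (continuous_of_derive _ _ _ (is_derive_model_G B _)).
      * apply (continuous_minus (V := R_NormedModule)).
        -- apply (continuous_comp (fun x => u (time B x) + sqrt x * q x) f).
           ++ apply (continuous_plus (V := R_NormedModule)); [exact Cu|].
              apply continuous_mult_R; [exact Cs|apply Cq, Hx].
           ++ apply Hf; [exact Ht|exact W].
        -- apply (continuous_comp (fun x => u (time B x)) f); assumption.
    + apply (ex_derive_continuous (V := R_NormedModule)); auto_derive.
      split; lra.
Qed.

(** The equation for w is the one that u + w solves, minus that for u: the defect of u reappears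
    with opposite sign as a source. *)
Lemma perturbed_solution : exists w w' : R -> R, forall t, T < t ->
  Rabs (w t) <= 410 * B * rho t * m t /\
  is_derive w t (w' t) /\
  is_derive w' t (- (exp (- t) / 4 * (f (u t + w t) - f (u t)))
    + m t * (t / (t + 1)) ^ 2 * d t).
Proof.
  destruct (forced_oscillator S (41 * B) M h h' N) as (q & q' & H).
  - apply weight_perturbation.
  - lra.
  - intros x Hx; destruct (perturbation_pos x Hx) as (Ht & Hx4 & Hs & Ht0 & E).
    unfold h, h'.
    assert (DF := is_derive_forcing B d d' m a (time B x) Ht0 (Dd _ Ht) (Dm _ Ht)).
    assert (DF' := is_derive_comp (V := R_NormedModule) _ _ _ _ _ DF (is_derive_time B x)).
    simpl in DF'.
    evar_last.
    + apply (is_derive_div (fun x => forcing B d m (time B x)) sqrt); [exact DF'| |lra].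
      apply (is_derive_sqrt (fun x => x) x 1); [|lra].
      apply (is_derive_id (K := R_AbsRing)).
    + unfold scal; simpl; unfold mult; simpl.
      assert (Ex : x = sqrt x * sqrt x) by (symmetry; apply sqrt_sqrt; lra).
      set (F := forcing B d m (time B x)); set (F' := forcing' B d d' m a (time B x)).
      set (y := sqrt x) in *. rewrite Ex. field; lra.
  - intros x Hx; destruct (perturbation_pos x Hx) as (Ht & Hx4 & Hs & Ht0 & E).
    assert (CF : continuous (fun x => forcing B d m (time B x)) x).
    { apply continuous_time.
      apply (continuous_of_derive _ _ _ (is_derive_forcing B d d' m a _ Ht0 (Dd _ Ht) (Dm _ Ht))). }
    assert (Cm := continuous_of_derive _ _ _ (Dm _ Ht)).
    assert (Cd := continuous_of_derive _ _ _ (Dd _ Ht)).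
    unfold h'; apply (continuous_minus (V := R_NormedModule)).
    + apply continuous_mult_R; [apply continuous_mult_R|].
      * apply (continuous_time B (forcing' B d d' m a)); unfold forcing'.
        repeat apply continuous_mult_R;
          try apply (continuous_plus (V := R_NormedModule));
          try apply continuous_mult_R; auto; try apply continuous_const.
        -- apply (ex_derive_continuous (V := R_NormedModule)); auto_derive.
           apply Rgt_not_eq, (pow_lt (time B x + 1) 3); lra.
        -- apply (ex_derive_continuous (V := R_NormedModule)); auto_derive.
           apply Rgt_not_eq, (pow_lt (time B x + 1) 2); lra.
        -- apply (continuous_minus (V := R_NormedModule)); [apply Cd', Ht|].
           apply continuous_mult_R; [exact Cd|]; apply continuous_mult_R; [|apply Ca, Ht].
           apply (ex_derive_continuous (V := R_NormedModule)); auto_derive; lra.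
      * apply (ex_derive_continuous (V := R_NormedModule)); auto_derive; exact I.
      * apply (ex_derive_continuous (V := R_NormedModule)); auto_derive; split; lra.
    + apply continuous_mult_R; [exact CF|].
      apply (ex_derive_continuous (V := R_NormedModule)); auto_derive; split; [lra|].
      split; [|exact I]. apply Rgt_not_eq; nra.
  - intros x Hx; destruct (perturbation_pos x Hx) as (Ht & Hx4 & Hs & Ht0 & E).
    destruct (forcing_bound B (rho (time B x)) d d' m a (time B x)) as [F1 _]; auto; try lra.
    { apply Rlt_le, Hm, Ht. }
    unfold h, Rdiv; rewrite Rabs_mult, (Rabs_pos_eq (/ sqrt x))
      by (apply Rlt_le, Rinv_0_lt_compat, Hs).
    apply Rmult_le_compat_r; [apply Rlt_le, Rinv_0_lt_compat, Hs|].
    apply Rle_trans with (1 := F1).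
    assert (P := proj1 (proj2 weight_perturbation) x Hx); unfold M in *; nra.
  - intros x Hx; destruct (perturbation_pos x Hx) as (Ht & Hx4 & Hs & Ht0 & E).
    destruct (forcing_bound B (rho (time B x)) d d' m a (time B x)) as [F1 F2]; auto; try lra.
    { apply Rlt_le, Hm, Ht. }
    assert (P := proj1 (proj2 weight_perturbation) x Hx).
    fold (M x) in F1, F2.
    assert (Hxs : 0 < x * sqrt x) by (apply Rmult_lt_0_compat; lra).
    unfold h'.
    (* 41 = 40 + 1: dt/dx = B x/2 and t = B x^2/4 turn 20/t into 40/x, and differentiating 1 / sqrt
       x contributes 2/2. *)
    replace (41 * B * M x / (x * sqrt x)) with
      (20 * B * M x / time B x * (B / 2 * x / sqrt x) + 2 * B * M x * (/ (2 * (x * sqrt x))))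
      by (rewrite E; field; repeat split; lra).
    unfold Rminus; apply Rle_trans with (1 := Rabs_triang _ _); rewrite Rabs_Ropp.
    apply Rplus_le_compat.
    + unfold Rdiv at 1; rewrite Rmult_assoc, Rabs_mult.
      change (B / 2 * x * / sqrt x) with (B / 2 * x / sqrt x).
      assert (Z : 0 <= B / 2 * x / sqrt x)
        by (apply Rdiv_le_0_compat; [apply Rmult_le_pos; lra|exact Hs]).
      rewrite (Rabs_pos_eq _ Z); apply Rmult_le_compat_r; assumption.
    + unfold Rdiv at 1; rewrite Rabs_mult.
      assert (Z : 0 <= / (2 * (x * sqrt x))) by (apply Rlt_le, Rinv_0_lt_compat; lra).
      rewrite (Rabs_pos_eq _ Z); apply Rmult_le_compat_r; assumption.
  - intros x Hx; destruct (perturbation_pos x Hx) as (Ht & Hx4 & Hs & Ht0 & E).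
    unfold N; rewrite (Rmult_0_r (sqrt x)), (Rplus_0_r (u _)); field; lra.
  - apply N_lipschitz.
  - apply N_continuous.
  - set (w := fun t => sqrt (phase B t) * q (phase B t)).
    assert (DL := is_derive_liouville B T q q' (fun x => h x + N x (q x) - q x)
      ltac:(lra) ltac:(lra) (fun x Hx => proj1 (H x Hx)) (fun x Hx => proj1 (proj2 (H x Hx)))).
    cbv zeta in DL.
    exists w; eexists; intros t Ht.
    destruct (DL t Ht) as [D1 D2].
    assert (Hx : S < phase B t) by (apply phase_lt; lra).
    assert (Et := time_phase B t ltac:(lra) ltac:(lra)).
    split; [|split; [exact D1|]].
    + unfold w; rewrite <- Et at 3 4.
      apply perturbation_small; [exact Hx|apply H, Hx].
    + evar_last; [exact D2|].
      destruct (perturbation_pos _ Hx) as (_ & Hx4 & Hs & _).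
      unfold h, N, forcing, w; rewrite !Et; cbv zeta.
      set (x := phase B t) in *. 
      (* G replaces the exponential because [N] is written with G = F(u~). *)
      replace (exp (- t)) with (model_G B t * 4 / (B * (t + 1)))
        by (unfold model_G; field; lra).
      set (fw := f (u t + sqrt x * q x)). set (G := model_G B t).
      field; repeat split; lra.
Qed.

End Perturbation.

(** * Singular profile *)

(** The function s - mass/4 has slope at least 7/8, as the mass has slope below 1/2. It bounds u~ +
    w from below, keeping it in the domain of f and sending it to infinity. *)
Lemma filterlim_minus_mass (s0 s1 : R) (f : R -> R) :
  cond_f1 s0 f -> s0 < s1 ->
  (forall s, s1 < s -> / 2 < Derive f s * tail f s < 3 / 2) ->
  filterlim (fun s => s - mass f s / 4) (Rbar_locally p_infty) (Rbar_locally p_infty).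
Proof.
  intros H H01 Hb.
  set (c := s1 + 1 - mass f (s1 + 1) / 4).
  apply (is_lim_le_p_loc (fun s => c + (s - (s1 + 1)) / 2) _ p_infty).
  - exists (s1 + 1); intros s Hs.
    destruct (MVT_derive (fun s => s - mass f s / 4)
      (fun s => 1 - (Derive f s * tail f s - 1) / 4) (s1 + 1) s) as [z [Iz Ez]].
    + intros z Iz; rewrite Rmin_left in Iz by lra.
      apply (is_derive_minus (V := R_NormedModule)).
      * apply (is_derive_id (K := R_AbsRing)).
      * assert (Dm := is_derive_mass s0 f z H ltac:(lra)).
        apply is_derive_ext with (fun s => scal (/ 4) (mass f s)).
        { intros y; unfold scal; simpl; unfold mult; simpl; field. }
        evar_last; [apply (is_derive_scal (mass f)), Dm|]. simpl; field.
    + rewrite Rmin_left in Iz by lra.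
      assert (Hz := Hb z ltac:(lra)); fold c in Ez; nra.
  - intros P [K HK]; exists (2 * (K - c) + (s1 + 1)); intros s Hs; apply HK; lra.
Qed.

(** [model_A1] is 1 - g'G and [model_A2] is g g''G^2 - g'G, both as functions of t. *)
Definition model_A1 (B t : R) : R := (1 + (t + 1) / B) / t ^ 2.
Definition model_A2 (B t : R) : R := (t + 1) * (t / B + 2 + 2 / B) / t ^ 4.

(** The instance f = g of the law a' = -(t/(t+1)) b proved for general f in [singular_profile];
    subtracting the two expresses d' through the difference in R_2. *)
Lemma is_derive_model_A1 (B t : R) : 0 < B -> 0 < t ->
  is_derive (model_A1 B) t (- (t / (t + 1) * model_A2 B t)).
Proof.
  intros HB Ht; unfold model_A1, model_A2; auto_derive.
  - apply Rgt_not_eq; nra.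
  - field; repeat split; lra.
Qed.

Lemma model_A1_bounds (B t : R) : 1 <= B -> 1 <= t -> / (B * t) <= model_A1 B t <= 3 / t.
Proof.
  intros HB Ht; unfold model_A1.
  assert (HBi : 0 < / B <= 1)
    by (split; [apply Rinv_0_lt_compat; lra|rewrite <- Rinv_1; apply Rinv_le_contravar; lra]).
  assert (Ht2 : 0 < t ^ 2) by (apply pow_lt; lra).
  split.
  - apply Rle_div_r; [exact Ht2|].
    replace (/ (B * t) * t ^ 2) with (t * / B) by (field; lra). unfold Rdiv; nra.
  - apply Rle_div_l; [exact Ht2|].
    replace (3 / t * t ^ 2) with (3 * t) by (field; lra). unfold Rdiv; nra.
Qed.

(** With B <= t/8, (B/4)(t + 1) <= (1 + t/4)^2 <= e^(t/2). *)
Lemma ln_model_G_le (B t : R) : 1 <= B -> 8 * B <= t -> t / 2 <= - ln (model_G B t).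
Proof.
  intros HB Ht.
  assert (HG : 0 < model_G B t)
    by (apply Rmult_lt_0_compat; [nra|apply exp_pos]).
  cut (ln (model_G B t) <= - (t / 2)); [lra|].
  rewrite <- (ln_exp (- (t / 2))).
  apply ln_le; [exact HG|].
  unfold model_G.
  replace (exp (- (t / 2))) with (exp (t / 4) * exp (t / 4) * exp (- t))
    by (rewrite <- !exp_plus; f_equal; field).
  apply Rmult_le_compat_r; [apply Rlt_le, exp_pos|].
  generalize (exp_ineq1_le (t / 4)); nra.
Qed.

Definition profile_approx (s0 : R) (f : R -> R) (B t : R) : R := tail_inv s0 f (model_G B t).

Definition radial_rem (s0 : R) (f : R -> R) (B t : R) : R :=
  Rabs (recip_B1 f (profile_approx s0 f B t) - - ln (model_G B t) * model_A1 B t)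
  + Rabs (recip_B2 f (profile_approx s0 f B t) - ln (model_G B t) ^ 2 * model_A2 B t).

Lemma model_G_pos (B t : R) : 1 <= B -> 0 < t -> 0 < model_G B t.
Proof. intros HB Ht; apply Rmult_lt_0_compat; [nra|apply exp_pos]. Qed.

Lemma filterlim_profile_approx (s0 : R) (f : R -> R) (B : R) : cond_f1 s0 f -> 1 <= B ->
  filterlim (profile_approx s0 f B) (Rbar_locally p_infty) (Rbar_locally p_infty).
Proof.
  intros H HB P [K HK].
  set (s := Rmax K s0 + 1).
  assert (Hs : s0 < s) by (unfold s; generalize (Rmax_r K s0); lra).
  assert (HsK : K < s) by (unfold s; generalize (Rmax_l K s0); lra).
  assert (HF := tail_pos s0 f s H Hs).
  destruct (filterlim_model_G B (fun y => y < tail f s) (open_lt _ _ HF)) as [T HT].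
  exists (Rmax T 0); intros t Ht; apply HK.
  generalize (Rmax_l T 0) (Rmax_r T 0); intros T1 T2.
  assert (HG := HT t ltac:(lra)); simpl in HG.
  assert (HG' := model_G_pos B t HB ltac:(lra)).
  generalize (tail_tail_inv s0 f s (model_G B t) H Hs (conj HG' HG)); unfold profile_approx; lra.
Qed.

Lemma tail_profile_approx (s0 : R) (f : R -> R) (B : R) : cond_f1 s0 f -> 1 <= B ->
  exists T, 0 < T /\ forall t, T < t -> s0 < profile_approx s0 f B t /\ tail f (profile_approx s0 f B t) = model_G B t.
Proof.
  intros H HB.
  assert (HF := tail_pos s0 f (s0 + 1) H ltac:(lra)).
  destruct (filterlim_model_G B (fun y => y < tail f (s0 + 1)) (open_lt _ _ HF)) as [T HT].
  exists (Rmax T 0 + 1); generalize (Rmax_l T 0) (Rmax_r T 0); intros T1 T2.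
  split; [lra|]; intros t Ht.
  assert (HG := HT t ltac:(lra)); simpl in HG.
  assert (HG' := model_G_pos B t HB ltac:(lra)).
  generalize (tail_tail_inv s0 f (s0 + 1) (model_G B t) H ltac:(lra) (conj HG' HG)).
  unfold profile_approx; split; [lra|apply H0].
Qed.

Lemma is_derive_profile_approx (s0 : R) (f : R -> R) (B t : R) : cond_f1 s0 f -> 0 < t ->
  s0 < profile_approx s0 f B t -> tail f (profile_approx s0 f B t) = model_G B t ->
  is_derive (profile_approx s0 f B) t (t / (t + 1) * mass f (profile_approx s0 f B t)).
Proof.
  intros H Ht Hu E.
  assert (D := is_derive_tail_inv s0 f _ H Hu); rewrite E in D.
  evar_last.
  - apply (is_derive_comp (V := R_NormedModule) (tail_inv s0 f) (model_G B)).
    + exact D.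
    + apply is_derive_model_G.
  - unfold mass; rewrite E; unfold scal; simpl; unfold mult, model_G; simpl.
    field; lra.
Qed.

Lemma singular_profile (s0 : R) (f : R -> R) (B T0 : R) (rho : R -> R) :
  cond_f1 s0 f -> cond_f2 f B ->
  (forall t, T0 < t -> radial_rem s0 f B t <= rho t) ->
  (forall s t, T0 < s -> s <= t -> rho t <= rho s) ->
  filterlim (fun t => sqrt t * rho t) (Rbar_locally p_infty) (locally 0) ->
  exists T psi psi', 
    filterlim psi (Rbar_locally p_infty) (Rbar_locally p_infty) /\
    forall t, T < t ->
      s0 < psi t /\
      is_derive psi t (psi' t) /\
      is_derive psi' t (- (exp (- t) / 4 * f (psi t))) /\
      Rabs (psi t - profile_approx s0 f B t) <= 410 * B * (mass f (profile_approx s0 f B t) * rho t).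
Proof.
  intros H H2 Hrem Hmon Hlim.
  assert (HB : 1 <= B) by apply H2.
  destruct (cond_f2_bounds s0 f B H H2) as (s1 & H01 & Hb).
  destruct (tail_profile_approx s0 f B H HB) as (T1 & HT1 & Hut).
  assert (LM := filterlim_minus_mass s0 s1 f H H01 (fun s Hs => proj1 (Hb s Hs))).
  assert (LU := filterlim_comp _ _ _ _ _ _ _ _ (filterlim_profile_approx s0 f B H HB) LM).
  destruct (LU (fun y => s1 < y) ltac:(exists s1; auto)) as [T2 HT2].
  assert (e0 : 0 < / (128 * 410 * B)) by (apply Rinv_0_lt_compat; lra).
  destruct (Hlim (fun y => y < / (128 * 410 * B)) (open_lt _ _ e0)) as [T3 HT3].
  cbv beta in HT2, HT3.
  (* T/B >= 200^2 makes the phase at least 400; it also gives the 8 B <= t of [ln_model_G_le]. *)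
  set (T := Rmax (Rmax T0 T1) (Rmax T2 T3) + 40000 * B).
  assert (G0 : T0 < T /\ T1 < T /\ T2 < T /\ T3 < T).
  { unfold T; generalize (Rmax_l (Rmax T0 T1) (Rmax T2 T3)) (Rmax_r (Rmax T0 T1) (Rmax T2 T3))
     (Rmax_l T0 T1) (Rmax_r T0 T1) (Rmax_l T2 T3) (Rmax_r T2 T3); lra. }
  assert (GT : 40000 * B < T).
  { unfold T; generalize (Rmax_l (Rmax T0 T1) (Rmax T2 T3)) (Rmax_r T0 T1); lra. }
  set (u := profile_approx s0 f B) in *.
  set (m := fun t => mass f (u t)).
  set (a := fun t => 1 - Derive f (u t) * tail f (u t)).
  (* This is 1/B_2 at u~ divided by (log G)^2, and a' = -(t/(t+1)) b. *)
  set (b := fun t => Derive_n f 2 (u t) * m t * tail f (u t) - Derive f (u t) * tail f (u t)).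
  set (d := fun t => a t - model_A1 B t).
  set (d' := fun t => - (t / (t + 1) * (b t - model_A2 B t))).
  assert (Hu : forall t, T < t -> s0 < u t /\ tail f (u t) = model_G B t)
    by (intros; apply Hut; lra).
  assert (Hm : forall t, T < t -> 0 < m t)
    by (intros t Ht; apply (mass_pos s0); [exact H|apply Hu, Ht]).
  assert (Du : forall t, T < t -> is_derive u t (t / (t + 1) * m t)).
  { intros t Ht; apply is_derive_profile_approx; auto; [lra| |]; apply Hu, Ht. }
  assert (Dc : forall g g' t, T < t -> is_derive g (u t) g' ->
     is_derive (fun t => g (u t)) t (t / (t + 1) * m t * g')).
  { intros g g' t Ht Dg.
    apply (is_derive_comp (V := R_NormedModule) g u t _ _ Dg (Du t Ht)). }
  assert (Da : forall t, T < t -> is_derive a t (- (t / (t + 1) * b t))).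
  { intros t Ht; destruct (Hu t Ht) as [Hu0 _].
    assert (fp : 0 < f (u t)) by (destruct H as [_ H]; apply (H _ Hu0)).
    evar_last.
    - apply (Dc (fun s => 1 - Derive f s * tail f s)); [exact Ht|].
      apply (is_derive_minus (V := R_NormedModule)).
      + apply is_derive_const.
      + apply (is_derive_mult (Derive f) (tail f)).
        * apply (cond_f1_derive s0 f (u t) H Hu0).
        * apply (is_derive_tail s0 f (u t) H Hu0).
        * intros; apply Rmult_comm.
    - unfold b, m, mass; unfold minus, plus, opp, mult, zero; simpl. field; lra. }
  assert (Cc : forall (g : R -> R) t, T < t -> continuous g (u t) -> continuous (fun t => g (u t)) t).
  { intros g t Ht Cg; apply (continuous_comp u g); [|exact Cg].
    apply (continuous_of_derive u _ _ (Du t Ht)). }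
  assert (Hrho : forall t, T < t -> 0 <= rho t).
  { intros t Ht; apply Rle_trans with (2 := Hrem t ltac:(lra)).
    unfold radial_rem; apply Rplus_le_le_0_compat; apply Rabs_pos. }
  assert (Srho : forall t, T < t -> 410 * B * rho t * sqrt t <= / 128).
  { intros t Ht; assert (X := HT3 t ltac:(lra)).
    apply Rmult_lt_compat_l with (r := 410 * B) in X; [|lra].
    replace (410 * B * / (128 * 410 * B)) with (/ 128) in X by (field; lra). lra. }
  assert (BY : forall t, T < t -> t / 2 <= - ln (model_G B t))
    by (intros t Ht; apply ln_model_G_le; lra).
  assert (Bd : forall t, T < t -> Rabs (d t) <= 2 * rho t / t).
  { intros t Ht; assert (R0 := Hrem t ltac:(lra)); unfold radial_rem in R0.
    fold u in R0.
    assert (R1 : Rabs (recip_B1 f (u t) - - ln (model_G B t) * model_A1 B t) <= rho t)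
      by (generalize (Rabs_pos (recip_B2 f (u t) - ln (model_G B t) ^ 2 * model_A2 B t)); lra).
    replace (recip_B1 f (u t) - - ln (model_G B t) * model_A1 B t)
      with (- ln (model_G B t) * d t) in R1.
    2: { unfold recip_B1, d, a; rewrite (proj2 (Hu t Ht)); ring. }
    assert (Y := BY t Ht).
    rewrite Rabs_mult, (Rabs_pos_eq (- ln (model_G B t))) in R1 by lra.
    apply Rle_div_r; [lra|].
    generalize (Rabs_pos (d t)); nra. }
  assert (Bd' : forall t, T < t -> Rabs (d' t) <= 4 * rho t / t ^ 2).
  { intros t Ht; assert (R0 := Hrem t ltac:(lra)); unfold radial_rem in R0.
    fold u in R0.
    assert (R2 : Rabs (recip_B2 f (u t) - ln (model_G B t) ^ 2 * model_A2 B t) <= rho t)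
      by (generalize (Rabs_pos (recip_B1 f (u t) - - ln (model_G B t) * model_A1 B t)); lra).
    assert (Hd1 : 0 < Derive f (u t)) by (destruct H as [_ H]; apply (H _ (proj1 (Hu t Ht)))).
    assert (Y := BY t Ht).
    replace (recip_B2 f (u t) - ln (model_G B t) ^ 2 * model_A2 B t)
      with ((- ln (model_G B t)) ^ 2 * (b t - model_A2 B t)) in R2.
    2: { unfold recip_B2, b, m, mass; rewrite (proj2 (Hu t Ht)).
         set (L := ln (model_G B t)); field; lra. }
    rewrite Rabs_mult, (Rabs_pos_eq ((- ln (model_G B t)) ^ 2)) in R2 by apply pow2_ge_0.
    unfold d'; rewrite Rabs_Ropp, Rabs_mult.
    assert (X3 : 0 <= t / (t + 1) <= 1).
    { split; [apply Rdiv_le_0_compat; lra|]. apply Rle_div_l; lra. }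
    rewrite (Rabs_pos_eq (t / (t + 1))) by lra.
    assert (Hbp := Rabs_pos (b t - model_A2 B t)).
    apply Rle_trans with (Rabs (b t - model_A2 B t)); [nra|].
    apply Rle_div_r; [apply pow_lt; lra|].
    assert (Y2 : t ^ 2 / 4 <= (- ln (model_G B t)) ^ 2).
    { replace (t ^ 2 / 4) with ((t / 2) ^ 2) by field. apply pow_incr; lra. }
    nra. }
  (* rho <= 1/(2 B) keeps |d| below the lower bound 1/(B t) of [model_A1]. The resulting sign of a
     is what makes m nonincreasing. *)
  assert (Ba : forall t, T < t -> 0 <= a t <= 5 / t).
  { intros t Ht; assert (X := model_A1_bounds B t HB ltac:(lra)).
    assert (Y := Bd t Ht); apply Rabs_le_between in Y; unfold d in Y.
    assert (Z : rho t <= / (2 * B)).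
    { assert (Z := Srho t Ht).
      assert (1 <= sqrt t) by (rewrite <- sqrt_1; apply sqrt_le_1_alt; lra).
      apply Rmult_le_reg_l with (2 * B); [lra|]. rewrite Rinv_r by lra.
      generalize (Hrho t Ht); nra. }
    assert (Z1 : rho t <= 1).
    { apply Rle_trans with (1 := Z); rewrite <- Rinv_1; apply Rinv_le_contravar; lra. }
    assert (Hti : 0 < / t) by (apply Rinv_0_lt_compat; lra).
    assert (Z2 : 2 * rho t / t <= / (B * t)).
    { replace (/ (B * t)) with (2 * / (2 * B) * / t) by (field; lra).
      unfold Rdiv; apply Rmult_le_compat_r; lra. }
    assert (Z3 : 2 * rho t / t <= 2 / t) by (apply Rmult_le_compat_r; lra).
    replace (5 / t) with (3 / t + 2 / t) by (field; lra). lra. }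
  destruct (perturbed_solution B T f u m a d d' rho) as (w & w' & Hw); auto; try lra.
  - unfold phase.
    replace 400 with (2 * sqrt (200 * 200)) by (rewrite sqrt_square; lra).
    apply Rmult_le_compat_l; [lra|]; apply sqrt_le_1_alt.
    apply (proj1 (Rle_div_r (200 * 200) T B ltac:(lra))); lra.
  - intros t Ht; evar_last.
    + apply (Dc (mass f)); [exact Ht|]. apply (is_derive_mass s0); [exact H|apply Hu, Ht].
    + unfold a; ring.
  - intros t Ht; unfold d, d'; evar_last.
    + apply (is_derive_minus (V := R_NormedModule)).
      * apply Da, Ht.
      * apply is_derive_model_A1; lra.
    + unfold minus, plus, opp; simpl; ring.
  - intros t Ht; destruct (Hu t Ht) as [Hu0 _].
    destruct (cond_f1_derive s0 f (u t) H Hu0) as (D0 & D1 & C2).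
    unfold d', b, m, model_A2.
    apply (continuous_opp (V := R_NormedModule)), continuous_mult_R.
    + apply (ex_derive_continuous (V := R_NormedModule)); auto_derive; lra.
    + apply (continuous_minus (V := R_NormedModule)).
      * apply (Cc (fun s => Derive_n f 2 s * mass f s * tail f s - Derive f s * tail f s)); auto.
        assert (Ct := continuous_of_derive _ _ _ (is_derive_tail s0 f (u t) H Hu0)).
        apply (continuous_minus (V := R_NormedModule)).
        -- apply continuous_mult_R; [apply continuous_mult_R; [exact C2|]|exact Ct].
           apply (continuous_of_derive _ _ _ (is_derive_mass s0 f (u t) H Hu0)).
        -- apply continuous_mult_R; [|exact Ct]. apply (continuous_of_derive _ _ _ D1).
      * apply (ex_derive_continuous (V := R_NormedModule)); auto_derive.
        apply Rgt_not_eq, (pow_lt t 4); lra.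
  - intros t Ht; apply (continuous_of_derive a _ _ (Da t Ht)).
  - intros s t Hs; apply Hmon; lra.
  - intros t k w1 w2 Ht Hk Hw1 Hw2; unfold a.
    rewrite <- (proj2 (Hu t Ht)).
    replace (1 - (1 - Derive f (u t) * tail f (u t))) with (Derive f (u t) * tail f (u t))
      by ring.
    apply (nonlinear_remainder s0 s1); auto; [apply Hu, Ht|apply HT2; lra].
  - intros t v Ht Hv; apply (cond_f1_continuous s0); [exact H|].
    apply Rabs_le_between in Hv; assert (X := HT2 t ltac:(lra)); fold (m t) in X; lra.
  - assert (Sm : forall t, T < t -> Rabs (w t) <= m t / 4).
    { intros t Ht; apply Rle_trans with (1 := proj1 (Hw t Ht)).
      assert (X := Srho t Ht).
      assert (Y : 1 <= sqrt t) by (rewrite <- sqrt_1; apply sqrt_le_1_alt; lra).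
      assert (0 <= 410 * B * rho t) by (apply Rmult_le_pos; [lra|apply Hrho, Ht]).
      generalize (Hm t Ht); nra. }
    exists T, (fun t => u t + w t), (fun t => t / (t + 1) * m t + w' t).
    split.
    + apply (is_lim_le_p_loc (fun t => u t - m t / 4) _ p_infty); [|exact LU].
      exists T; intros t Ht; generalize (proj1 (Rabs_le_between _ _) (Sm t Ht)); lra.
    + intros t Ht; destruct (Hw t Ht) as (W1 & W2 & W3).
      split; [|split; [|split]].
      * generalize (proj1 (Rabs_le_between _ _) (Sm t Ht)) (HT2 t ltac:(lra)); fold (m t); lra.
      * apply (is_derive_plus (V := R_NormedModule)); [apply Du, Ht|exact W2].
      * evar_last.
        -- apply (is_derive_plus (V := R_NormedModule)); [|exact W3].
           apply (is_derive_mult (fun t => t / (t + 1)) m t (/ (t + 1) ^ 2)).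
           ++ auto_derive; [lra|field; lra].
           ++ apply (Dc (mass f)); [exact Ht|]. apply (is_derive_mass s0); [exact H|apply Hu, Ht].
           ++ intros; apply Rmult_comm.
        -- unfold plus, mult; simpl.
           assert (E : exp (- t) / 4 * f (u t) = m t / (B * (t + 1))).
           { unfold m, mass; rewrite (proj2 (Hu t Ht)); unfold model_G; field; lra. }
           unfold d, a, model_A1.
           (* In u~'' the [model_A1] part of a gives exactly -e^(-t) f(u~)/4; the remaining d part
              cancels against the source in w''. *)
           replace (exp (- t) / 4 * (f (u t + w t) - f (u t)))
             with (exp (- t) / 4 * f (u t + w t) - m t / (B * (t + 1))) by (rewrite <- E; ring).
           field; lra.
      * replace (u t + w t - u t) with (w t) by ring.
        apply Rle_trans with (1 := W1); right; unfold m; ring.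
Qed.

(** * Radial functions on the plane *)

(** Replaces the [Derive] terms in [ex_diff_n] by explicit partial derivatives known near the
    point. *)
Lemma ex_diff_n_S_loc (f fx fy : R -> R -> R) (n : nat) (x y : R) :
  continuity_2d_pt f x y ->
  locally_2d (fun u v => is_derive (fun z => f z v) u (fx u v) /\
    is_derive (fun z => f u z) v (fy u v)) x y ->
  ex_diff_n fx n x y -> ex_diff_n fy n x y -> ex_diff_n f (S n) x y.
Proof.
  intros Hc Hd Hx Hy; destruct (locally_2d_singleton _ _ _ Hd) as [D1 D2].
  split; [exact Hc|]; split; [eexists; exact D1|]; split; [eexists; exact D2|].
  split.
  - apply ex_diff_n_ext_loc with (2 := Hx).
    apply locally_2d_impl with (2 := Hd), locally_2d_forall.
    intros u v [D _]; symmetry; apply is_derive_unique, D.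
  - apply ex_diff_n_ext_loc with (2 := Hy).
    apply locally_2d_impl with (2 := Hd), locally_2d_forall.
    intros u v [_ D]; symmetry; apply is_derive_unique, D.
Qed.

Section Radial.

Variables (p p1 p2 : R -> R) (r : R).
Hypothesis D1 : forall n, 0 < n < r -> is_derive p n (p1 n).
Hypothesis D2 : forall n, 0 < n < r -> is_derive p1 n (p2 n).
Hypothesis C2 : forall n, 0 < n < r -> continuous p2 n.

Let sq x y := x ^ 2 + y ^ 2.

Lemma continuity_2d_pt_sq (x y : R) : continuity_2d_pt sq x y.
Proof.
  apply continuity_2d_pt_ext with (fun x y => x * x + y * y); [intros; unfold sq; ring|].
  apply continuity_2d_pt_plus; apply continuity_2d_pt_mult;
    (apply continuity_2d_pt_id1 || apply continuity_2d_pt_id2).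
Qed.

Lemma locally_2d_sq (x y : R) : 0 < sq x y < r -> locally_2d (fun u v => 0 < sq u v < r) x y.
Proof.
  intros H.
  assert (He : 0 < Rmin (sq x y) (r - sq x y)) by (apply Rmin_glb_lt; lra).
  generalize (continuity_2d_pt_sq x y (mkposreal _ He)); simpl; intros L.
  apply locally_2d_impl with (2 := L), locally_2d_forall; intros u v Huv.
  apply Rabs_def2 in Huv.
  generalize (Rmin_l (sq x y) (r - sq x y)) (Rmin_r (sq x y) (r - sq x y)); lra.
Qed.

Lemma continuity_2d_pt_radial (g : R -> R) (x y : R) :
  continuous g (sq x y) -> continuity_2d_pt (fun u v => g (sq u v)) x y.
Proof.
  intros Hg; apply (continuity_1d_2d_pt_comp g sq).
  - apply continuity_pt_filterlim, Hg.
  - apply continuity_2d_pt_sq.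
Qed.

Lemma is_derive_radial (g : R -> R) (l u v : R) : is_derive g (sq u v) l ->
  is_derive (fun z => g (sq z v)) u (2 * u * l) /\
  is_derive (fun z => g (sq u z)) v (2 * v * l).
Proof.
  intros H; split.
  - apply (is_derive_comp (V := R_NormedModule) g (fun z => sq z v)); [exact H|].
    unfold sq; auto_derive; [exact I|ring].
  - apply (is_derive_comp (V := R_NormedModule) g (fun z => sq u z)); [exact H|].
    unfold sq; auto_derive; [exact I|ring].
Qed.

Lemma is_derive_id_mult (g : R -> R) (u l : R) : is_derive g u l ->
  is_derive (fun z => 2 * z * g z) u (2 * g u + 2 * u * l).
Proof.
  intros H; assert (V : Derive (fun y => g y) u = l) by (apply is_derive_unique, H).
  auto_derive; [exists l; exact H|rewrite V; ring].
Qed.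

(** The radial variable is |x|^2 rather than |x|: it is polynomial, so no square root is
    differentiated, and the Laplacian reads 4 p' + 4 n p''. *)
Lemma ex_diff_n_radial (x y : R) : 0 < sq x y < r ->
  ex_diff_n (fun u v => p (sq u v)) 2 x y /\
  Derive_n (fun u => p (sq u y)) 2 x + Derive_n (fun v => p (sq x v)) 2 y
    = 4 * p1 (sq x y) + 4 * sq x y * p2 (sq x y).
Proof.
  intros H.
  assert (L := locally_2d_sq x y H).
  assert (E1 : forall u v, 0 < sq u v < r ->
    is_derive (fun z => p (sq z v)) u (2 * u * p1 (sq u v)) /\
    is_derive (fun z => p (sq u z)) v (2 * v * p1 (sq u v)))
    by (intros; apply is_derive_radial, D1; assumption).
  assert (E2 : forall u v, 0 < sq u v < r ->
    is_derive (fun z => 2 * z * p1 (sq z v)) u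
      (2 * p1 (sq u v) + 2 * u * (2 * u * p2 (sq u v))) /\
    is_derive (fun z => 2 * u * p1 (sq u z)) v (2 * u * (2 * v * p2 (sq u v)))).
  { intros u v Huv; destruct (is_derive_radial p1 _ u v (D2 _ Huv)) as [F1 F2]; split.
    - apply (is_derive_id_mult (fun z => p1 (sq z v))), F1.
    - apply (is_derive_scal (fun z => p1 (sq u z)) v (2 * u)), F2. }
  assert (E3 : forall u v, 0 < sq u v < r ->
    is_derive (fun z => 2 * v * p1 (sq z v)) u (2 * v * (2 * u * p2 (sq u v))) /\
    is_derive (fun z => 2 * z * p1 (sq u z)) v
      (2 * p1 (sq u v) + 2 * v * (2 * v * p2 (sq u v)))).
  { intros u v Huv; destruct (is_derive_radial p1 _ u v (D2 _ Huv)) as [F1 F2]; split.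
    - apply (is_derive_scal (fun z => p1 (sq z v)) u (2 * v)), F1.
    - apply (is_derive_id_mult (fun z => p1 (sq u z))), F2. }
  assert (Cp : continuous p (sq x y)) by (apply (continuous_of_derive p _ _ (D1 _ H))).
  assert (Cp1 := continuity_2d_pt_radial p1 x y (continuous_of_derive p1 _ _ (D2 _ H))).
  assert (Cp2 := continuity_2d_pt_radial p2 x y (C2 _ H)).
  split.
  - apply ex_diff_n_S_loc with (fun u v => 2 * u * p1 (sq u v)) (fun u v => 2 * v * p1 (sq u v)).
    + apply continuity_2d_pt_radial, Cp.
    + apply locally_2d_impl with (2 := L), locally_2d_forall; exact E1.
    + eapply ex_diff_n_S_loc;
        [|apply locally_2d_impl with (2 := L), locally_2d_forall; exact E2| |].
      * apply continuity_2d_pt_mult; [|exact Cp1].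
        apply continuity_2d_pt_mult; [apply continuity_2d_pt_const|apply continuity_2d_pt_id1].
      * split; [|exact I].
        repeat (apply continuity_2d_pt_plus || apply continuity_2d_pt_mult
          || apply continuity_2d_pt_const || apply continuity_2d_pt_id1
          || apply continuity_2d_pt_id2 || assumption).
      * split; [|exact I].
        repeat (apply continuity_2d_pt_plus || apply continuity_2d_pt_mult
          || apply continuity_2d_pt_const || apply continuity_2d_pt_id1
          || apply continuity_2d_pt_id2 || assumption).
    + eapply ex_diff_n_S_loc;
        [|apply locally_2d_impl with (2 := L), locally_2d_forall; exact E3| |].
      * apply continuity_2d_pt_mult; [|exact Cp1].
        apply continuity_2d_pt_mult; [apply continuity_2d_pt_const|apply continuity_2d_pt_id2].
      * split; [|exact I].
        repeat (apply continuity_2d_pt_plus || apply continuity_2d_pt_mult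
          || apply continuity_2d_pt_const || apply continuity_2d_pt_id1
          || apply continuity_2d_pt_id2 || assumption).
      * split; [|exact I].
        repeat (apply continuity_2d_pt_plus || apply continuity_2d_pt_mult
          || apply continuity_2d_pt_const || apply continuity_2d_pt_id1
          || apply continuity_2d_pt_id2 || assumption).
  - assert (F1 : Derive_n (fun u => p (sq u y)) 2 x
       = 2 * p1 (sq x y) + 2 * x * (2 * x * p2 (sq x y))).
    { apply is_derive_unique, is_derive_ext_loc with (fun z => 2 * z * p1 (sq z y)).
      - apply locally_2d_1d_const_y in L.
        generalize L; apply filter_imp; intros u Hu; symmetry.
        apply is_derive_unique, (E1 u y Hu).
      - apply E2, H. }
    assert (F2 : Derive_n (fun v => p (sq x v)) 2 y
       = 2 * p1 (sq x y) + 2 * y * (2 * y * p2 (sq x y))).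
    { apply is_derive_unique, is_derive_ext_loc with (fun z => 2 * z * p1 (sq x z)).
      - apply locally_2d_1d_const_x in L.
        generalize L; apply filter_imp; intros v Hv; symmetry.
        apply is_derive_unique, (E1 x v Hv).
      - apply E3, H. }
    rewrite F1, F2; unfold sq; ring.
Qed.

End Radial.

Lemma enorm_sq (x : R * R) : enorm x ^ 2 = fst x ^ 2 + snd x ^ 2.
Proof.
  unfold enorm, norm; simpl; unfold prod_norm, norm; simpl; unfold abs; simpl.
  rewrite !Rmult_1_r, sqrt_sqrt.
  - rewrite <- !Rabs_mult, !Rabs_pos_eq by nra; reflexivity.
  - apply Rplus_le_le_0_compat; apply Rle_0_sqr.
Qed.

Lemma enorm_nonneg (x : R * R) : 0 <= enorm x.
Proof. apply norm_ge_0. Qed.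

Lemma enorm_pos (x : R * R) : x <> origin -> 0 < enorm x.
Proof.
  intros H; destruct (enorm_nonneg x) as [l|e]; [exact l|exfalso; apply H].
  apply (norm_eq_zero x); symmetry; exact e.
Qed.

Lemma locally'_origin (P : R * R -> Prop) :
  locally' origin P <-> exists e, 0 < e /\ forall x, 0 < enorm x < e -> P x.
Proof.
  split.
  - intros [d Hd]; exists d; split; [apply cond_pos|]; intros x Hx; apply Hd.
    + split; unfold ball; simpl; unfold AbsRing_ball, abs, minus, plus, opp; simpl;
        rewrite Ropp_0, Rplus_0_r; apply Rle_lt_trans with (2 := proj2 Hx).
      * apply (norm_le_prod_norm_1 (U := R_NormedModule) (V := R_NormedModule) x).
      * apply (norm_le_prod_norm_2 (U := R_NormedModule) (V := R_NormedModule) x).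
    + intros ->; generalize (enorm_sq origin); simpl; intros E; nra.
  - intros (e & He & H).
    (* Balls of the product are squares; a square of half-side e/2 lies in the disc of radius e,
       since 2 (e/2)^2 < e^2. *)
    assert (He2 : 0 < e / 2) by lra.
    exists (mkposreal _ He2); intros x [B1 B2] Hx; apply H; split; [apply enorm_pos, Hx|].
    unfold ball in B1, B2; simpl in B1, B2.
    unfold AbsRing_ball, abs, minus, plus, opp in B1, B2; simpl in B1, B2.
    rewrite Ropp_0, Rplus_0_r in B1, B2.
    apply Rabs_def2 in B1, B2.
    assert (E := enorm_sq x); assert (N := enorm_nonneg x); nra.
Qed.

Definition log_radius (x : R * R) : R := - ln (fst x ^ 2 + snd x ^ 2).

Lemma log_radius_enorm (x : R * R) : 0 < enorm x ->
  log_radius x = ln (1 / enorm x ^ 2) /\ log_radius x = - 2 * ln (enorm x).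
Proof.
  intros Hx; unfold log_radius; rewrite <- enorm_sq.
  assert (E : ln (enorm x ^ 2) = 2 * ln (enorm x)).
  { simpl; rewrite Rmult_1_r, ln_mult by assumption; ring. }
  split; [|rewrite E; ring].
  unfold Rdiv; rewrite Rmult_1_l, ln_Rinv; [reflexivity|].
  apply pow_lt, Hx.
Qed.

Lemma log_radius_gt (T : R) (x : R * R) : 0 < enorm x ->
  T < log_radius x <-> enorm x < exp (- T / 2).
Proof.
  intros Hx; destruct (log_radius_enorm x Hx) as [_ ->]; split; intros H.
  - rewrite <- (exp_ln (enorm x) Hx); apply exp_increasing; lra.
  - apply ln_increasing in H; [|exact Hx]; rewrite ln_exp in H; lra.
Qed.

Lemma log_radius_le (x y : R * R) : 0 < enorm x -> 0 < enorm y ->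
  enorm y <= enorm x <-> log_radius x <= log_radius y.
Proof.
  intros Hx Hy.
  destruct (log_radius_enorm x Hx) as [_ ->]. destruct (log_radius_enorm y Hy) as [_ ->].
  split; intros H.
  - apply ln_le in H; [lra|exact Hy].
  - apply Rnot_lt_le; intros L; apply ln_increasing in L; [lra|exact Hx].
Qed.

Lemma locally'_log_radius (P : R * R -> Prop) :
  locally' origin P <-> exists T, forall x, 0 < enorm x -> T < log_radius x -> P x.
Proof.
  rewrite locally'_origin; split.
  - intros (e & He & H); exists (- 2 * ln e); intros x Hx Ht; apply H; split; [exact Hx|].
    apply log_radius_gt in Ht; [|exact Hx].
    replace (- (-2 * ln e) / 2) with (ln e) in Ht by field.
    rewrite exp_ln in Ht; assumption.
  - intros [T H]; exists (exp (- T / 2)); split; [apply exp_pos|].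
    intros x [Hx Ht]; apply H; [exact Hx|]; apply log_radius_gt; assumption.
Qed.

(** A representative of the circle [log_radius] = t, enough because [ball_sup] depends only on the
    norm of its point. *)
Definition point_at (t : R) : R * R := (exp (- t / 2), 0).

Lemma enorm_point_at (t : R) : 0 < enorm (point_at t) /\ log_radius (point_at t) = t.
Proof.
  assert (E : fst (point_at t) ^ 2 + snd (point_at t) ^ 2 = exp (- t)).
  { unfold point_at; simpl.
    rewrite Rmult_1_r, <- exp_plus. replace (- t / 2 + - t / 2) with (- t) by field. ring. }
  split.
  - destruct (enorm_nonneg (point_at t)) as [l|l]; [exact l|exfalso].
    generalize (enorm_sq (point_at t)) (exp_pos (- t)); rewrite E, <- l; simpl; lra.
  - unfold log_radius; rewrite E, ln_exp; ring.
Qed.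

(** The bound [M] excludes +oo and the value at [x] excludes -oo, so [real] returns the true
    supremum. *)
Lemma ball_sup_spec (h : R * R -> R) (x : R * R) (M : R) : 0 < enorm x ->
  (forall y, 0 < enorm y <= enorm x -> h y <= M) ->
  (forall y, 0 < enorm y <= enorm x -> h y <= ball_sup h x) /\ ball_sup h x <= M.
Proof.
  intros Hx HM; unfold ball_sup.
  destruct (Lub_Rbar_correct (fun r => exists y, 0 < enorm y <= enorm x /\ r = h y)) as [U L].
  set (l := Lub_Rbar _) in *.
  assert (LM : Rbar_le l M) by (apply L; intros r (y & Hy & ->); simpl; auto).
  assert (Ux : Rbar_le (h x) l) by (apply U; exists x; split; [lra|reflexivity]).
  destruct l as [l| |]; simpl in *; try contradiction.
  split; [|exact LM].
  intros y Hy; apply (U (h y)); exists y; auto.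
Qed.

Lemma ball_sup_ext (h : R * R -> R) (x y : R * R) :
  enorm x = enorm y -> ball_sup h x = ball_sup h y.
Proof. intros E; unfold ball_sup; rewrite E; reflexivity. Qed.

Lemma u_tilde_profile_approx (s0 : R) (f : R -> R) (B : R) (x : R * R) : 1 <= B -> 0 < enorm x ->
  1 < log_radius x -> u_tilde s0 f B x = profile_approx s0 f B (log_radius x).
Proof.
  intros HB Hx Ht; destruct (log_radius_enorm x Hx) as [E _]; rewrite E in Ht.
  destruct (model_t_model_v B x HB Ht) as [V1 V2].
  unfold u_tilde, profile_approx; rewrite tail_model_g, V2, <- E; auto.
Qed.

Lemma rem_radial (s0 : R) (f : R -> R) (B : R) (x : R * R) : 1 <= B -> 0 < enorm x ->
  2 < log_radius x ->
  rem1 s0 f B x + rem2 s0 f B x = radial_rem s0 f B (log_radius x).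
Proof.
  intros HB Hx Ht; assert (E := proj1 (log_radius_enorm x Hx)).
  destruct (model_t_model_v B x HB ltac:(lra)) as [V1 V2]; rewrite <- E in V2.
  assert (HBi : / B <= 1) by (rewrite <- Rinv_1; apply Rinv_le_contravar; lra).
  unfold rem1, rem2, radial_rem, model_A1, model_A2.
  rewrite recip_B1_model_g, recip_B2_model_g by (assumption || lra).
  rewrite V2, u_tilde_profile_approx by (assumption || lra); reflexivity.
Qed.

(** For p(n) = psi(- ln n), 4 p' + 4 n p'' reduces to 4 psi''/n with n = e^(-t). Continuity of psi''
    is read off the equation itself. *)
Lemma singular_solution_of_profile (s0 T : R) (f psi psi' : R -> R) :
  cond_f1 s0 f ->
  filterlim psi (Rbar_locally p_infty) (Rbar_locally p_infty) ->
  (forall t, T < t -> s0 < psi t /\ is_derive psi t (psi' t) /\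
     is_derive psi' t (- (exp (- t) / 4 * f (psi t)))) ->
  singular_solution s0 f (fun x => psi (log_radius x)).
Proof.
  intros H Hlim Hpsi.
  exists (exp (- T / 2)); split; [apply exp_pos|]; split.
  - intros [x y] [Hx HxT].
    assert (Ht := proj2 (log_radius_gt T _ Hx) HxT).
    assert (Hn : 0 < x ^ 2 + y ^ 2)
      by (generalize (enorm_sq (x, y)); simpl fst; simpl snd; intros <-; apply pow_lt, Hx).
    assert (LT : forall n, 0 < n < exp (- T) -> T < - ln n).
    { intros n [N1 N2]; apply ln_increasing in N2; [|exact N1].
      rewrite ln_exp in N2; lra. }
    assert (Hn2 : x ^ 2 + y ^ 2 < exp (- T)).
    { unfold log_radius in Ht; simpl fst in Ht; simpl snd in Ht.
      rewrite <- (exp_ln _ Hn); apply exp_increasing; lra. }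
    set (psi2 := fun t => - (exp (- t) / 4 * f (psi t))) in *.
    assert (Dl : forall (g : R -> R) g' n, 0 < n -> is_derive g (- ln n) g' ->
       is_derive (fun n => g (- ln n)) n (- / n * g')).
    { intros g g' n N Dg.
      apply (is_derive_comp (V := R_NormedModule) g (fun n => - ln n)); [exact Dg|].
      auto_derive; [exact N|field; lra]. }
    destruct (ex_diff_n_radial (fun n => psi (- ln n)) (fun n => - / n * psi' (- ln n))
      (fun n => (psi2 (- ln n) + psi' (- ln n)) / n ^ 2) (exp (- T))) with (x := x) (y := y)
      as [X1 X2].
    + intros n N; apply Dl; [lra|apply Hpsi, LT, N].
    + intros n N; evar_last.
      * apply (is_derive_mult (fun n => - / n) (fun n => psi' (- ln n)) n (/ n ^ 2)).
        -- auto_derive; [lra|field; lra].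
        -- apply Dl; [lra|apply Hpsi, LT, N].
        -- intros; apply Rmult_comm.
      * unfold plus, mult; simpl; fold (psi2 (- ln n)); field; lra.
    + intros n N.
      assert (Cl : forall g : R -> R, continuous g (- ln n) ->
        continuous (fun n => g (- ln n)) n).
      { intros g; apply (continuous_comp (fun n => - ln n) g).
        apply (ex_derive_continuous (V := R_NormedModule)); auto_derive; lra. }
      destruct (Hpsi _ (LT n N)) as (P1 & P2 & P3).
      apply continuous_mult_R.
      * apply (continuous_plus (V := R_NormedModule)); apply (Cl _).
        -- unfold psi2; apply (continuous_opp (V := R_NormedModule)), continuous_mult_R.
           ++ apply (ex_derive_continuous (V := R_NormedModule)); auto_derive; exact I.
           ++ apply (continuous_comp psi f); [apply (continuous_of_derive psi _ _ P2)|].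
              apply (cond_f1_continuous s0 f _ H P1).
        -- apply (continuous_of_derive psi' _ _ P3).
      * apply (ex_derive_continuous (V := R_NormedModule)); auto_derive.
        apply Rgt_not_eq; nra.
    + split; assumption.
    + destruct (Hpsi _ Ht) as (P1 & _).
      split; [|split; [exact P1|split; [exact X1|]]].
      * destruct H as [H _]; lra.
      * unfold laplacian, partial_derive; simpl fst; simpl snd.
        change (- (Derive_n (fun u => psi (- ln (u ^ 2 + y ^ 2))) 2 x
          + Derive_n (fun v => psi (- ln (x ^ 2 + v ^ 2))) 2 y)
          = f (psi (- ln (x ^ 2 + y ^ 2)))).
        rewrite X2; unfold psi2; rewrite Ropp_involutive, exp_ln by exact Hn.
        field; lra.
  - intros P HP; apply locally'_log_radius.
    destruct (Hlim P HP) as [T' HT']; exists T'; intros x _; apply HT'.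
Qed.

Theorem theorem2p1 (f : R -> R) (s0 B : R)
  (hf1 : cond_f1 s0 f) (hf2 : cond_f2 f B)
  (hR : filterlim
          (fun x : R * R =>
             sqrt (- ln (enorm x)) * (rem1 s0 f B x + rem2 s0 f B x))
          (locally' origin) (locally 0)) :
  exists u : R * R -> R,
    singular_solution s0 f u /\
    big_O (locally' origin)
      (fun x => u x - u_tilde s0 f B x)
      (fun x => f (u_tilde s0 f B x) * tail f (u_tilde s0 f B x) *
                ball_sup (fun y => rem1 s0 f B y + rem2 s0 f B y) x).
Proof.
  assert (HB : 1 <= B) by apply hf2.
  set (h := fun y => rem1 s0 f B y + rem2 s0 f B y) in *.
  set (rho := fun t => ball_sup h (point_at t)).
  (* Passes from - ln |x| to t = -2 ln |x|; the factor sqrt 2 is bounded by 2, whence e/2. *)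
  assert (hR' : forall e, 0 < e -> exists T, 2 <= T /\ forall x, 0 < enorm x ->
    T < log_radius x -> sqrt (log_radius x) * h x <= e).
  { intros e He.
    assert (He2 : 0 < e / 2) by lra.
    destruct (proj1 (locally'_log_radius _) (hR _ (open_lt _ _ He2))) as [T HT].
    cbv beta in HT.
    exists (Rmax T 2); split; [apply Rmax_r|]; intros x Hx Ht.
    generalize (Rmax_l T 2) (Rmax_r T 2); intros T1 T2.
    specialize (HT x Hx ltac:(lra)).
    assert (E := proj2 (log_radius_enorm x Hx)).
    change (sqrt (- ln (enorm x)) * h x < e / 2) in HT.
    assert (Hh : 0 <= h x) by (apply Rplus_le_le_0_compat; apply Rabs_pos).
    assert (Hs : sqrt (log_radius x) <= 2 * sqrt (- ln (enorm x))).
    { replace (2 * sqrt (- ln (enorm x))) with (sqrt (2 * 2 * - ln (enorm x))).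
      - apply sqrt_le_1_alt; lra.
      - rewrite sqrt_mult, sqrt_square by lra; reflexivity. }
    nra. }
  (* The decay passes to the supremum: points nearer the origin have larger t, so e / sqrt t bounds
     the remainder on the whole punctured disc. *)
  assert (Hsup : forall e, 0 < e -> exists T, 2 <= T /\ forall t, T < t ->
    (forall x, 0 < enorm x -> t <= log_radius x -> h x <= rho t) /\ sqrt t * rho t <= e).
  { intros e He; destruct (hR' e He) as (T & HT2 & HT); exists T; split; [exact HT2|].
    intros t Ht; destruct (enorm_point_at t) as [P1 P2].
    assert (Hst : 0 < sqrt t) by (apply sqrt_lt_R0; lra).
    destruct (ball_sup_spec h (point_at t) (e / sqrt t) P1) as [S1 S2].
    - intros y [Hy Hyt].
      apply log_radius_le in Hyt; auto; rewrite P2 in Hyt.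
      apply Rle_div_r; [exact Hst|].
      apply Rle_trans with (2 := HT y Hy ltac:(lra)).
      rewrite Rmult_comm; apply Rmult_le_compat_r.
      + apply Rplus_le_le_0_compat; apply Rabs_pos.
      + apply sqrt_le_1_alt, Hyt.
    - split.
      + intros x Hx Hxt; apply S1; split; [exact Hx|].
        apply log_radius_le; auto; rewrite P2; exact Hxt.
      + apply Rmult_le_reg_l with (/ sqrt t); [apply Rinv_0_lt_compat, Hst|].
        rewrite <- Rmult_assoc, Rinv_l, Rmult_1_l by lra.
        rewrite Rmult_comm; exact S2. }
  (* The value 1 is arbitrary; it fixes a [T0] beyond which [rho] is a finite supremum. *)
  destruct (Hsup 1 Rlt_0_1) as (T0 & HT0 & HS).
  assert (Hpt : forall t, T0 < t -> h (point_at t) = radial_rem s0 f B t).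
  { intros t Ht; destruct (enorm_point_at t) as [P1 P2].
    assert (X := rem_radial s0 f B (point_at t) HB P1 ltac:(rewrite P2; lra)).
    rewrite P2 in X; exact X. }
  assert (Hrho : forall t, T0 < t -> 0 <= rho t).
  { intros t Ht; apply Rle_trans with (h (point_at t)).
    - apply Rplus_le_le_0_compat; apply Rabs_pos.
    - destruct (enorm_point_at t) as [P1 P2].
      apply (proj1 (HS t Ht)); [exact P1|rewrite P2; lra]. }
  destruct (singular_profile s0 f B T0 rho hf1 hf2) as (T & psi & psi' & Hlim & Hpsi).
  - intros t Ht; rewrite <- Hpt by exact Ht.
    destruct (enorm_point_at t) as [P1 P2].
    apply (proj1 (HS t Ht)); [exact P1|rewrite P2; lra].
  - intros s t Hs Hst.
    destruct (enorm_point_at t) as [P1 P2].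
    apply (ball_sup_spec h (point_at t)); [exact P1|].
    intros y [Hy Hyt]; apply (proj1 (HS s Hs)); [exact Hy|].
    apply log_radius_le in Hyt; auto; rewrite P2 in Hyt; lra.
  - apply filterlim_locally; intros eps.
    assert (He : 0 < eps / 2) by (generalize (cond_pos eps); lra).
    destruct (Hsup _ He) as (T & HT2 & HT).
    exists (Rmax T T0); intros t Ht.
    generalize (Rmax_l T T0) (Rmax_r T T0); intros T1 T3.
    change (Rabs (sqrt t * rho t - 0) < eps).
    rewrite Rminus_0_r, Rabs_pos_eq.
    + apply Rle_lt_trans with (1 := proj2 (HT t ltac:(lra))); lra.
    + apply Rmult_le_pos; [apply sqrt_pos|apply Hrho; lra].
  - exists (fun x => psi (log_radius x)); split.
    + apply singular_solution_of_profile with T psi'; auto.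
      intros t Ht; destruct (Hpsi t Ht) as (Q1 & Q2 & Q3 & _); auto.
    + exists (410 * B); apply locally'_log_radius.
      exists (Rmax T T0); intros x Hx Ht.
      generalize (Rmax_l T T0) (Rmax_r T T0); intros T1 T3.
      destruct (Hpsi (log_radius x) ltac:(lra)) as (_ & _ & _ & Q).
      rewrite u_tilde_profile_approx by (assumption || lra).
      apply Rle_trans with (1 := Q), Rmult_le_compat_l; [lra|].
      rewrite (ball_sup_ext h x (point_at (log_radius x))).
      * apply Rle_abs.
      * destruct (enorm_point_at (log_radius x)) as [P1 P2].
        apply Rle_antisym; apply log_radius_le; auto; rewrite P2; lra.
Qed.
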